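(* Let $(G,\delta,\|\cdot\|)$ be a locally compact normed group with dilatations and let $(G^{(2)},\delta^{(2)},\|\cdot\|^{(2)})$ be the associated normed group with dilatations, where $G^{(2)}=G\times G$ has the operation $(x,u)(y,v)=(xy,\,y^{-1}uyv)$, $\delta^{(2)}_\varepsilon(x,y)=(\delta_\varepsilon x,\delta_\varepsilon y)$ and $\|(x,y)\|^{(2)}=\max\{\|x\|,\|y\|\}$. Then the group operation $op:G^{(2)}\to G$, $op(x,y)=xy$, is differentiable (with respect to the dilatations based at points and the distances associated with these two normed groups with dilatations).
   Context: **Parameters.** $\Gamma$ is a Hausdorff topological commutative group, written multiplicatively, with a continuous group morphism $\nu:\Gamma\to(0,+\infty)$ such that $\inf\nu(\Gamma)=0$ (basic case $\Gamma=(0,+\infty)$, $\nu=\mathrm{id}$). ''$\varepsilon\to0$'' means $\nu(\varepsilon)\to0$, and $\frac1\varepsilon$ as a real number means $\frac1{\nu(\varepsilon)}$. **Groups with dilatations.** A uniform group is a group $G$ with uniformities on $G$ and on $G^{(2)}$ such that $op(x,y)=xy$ ($G^{(2)}\to G$), $i'(x)=(x,e)$ and $i''(x)=(x,x^{-1})$ ($G\to G^{(2)}$) are uniformly continuous. A local (uniform) group is a uniform space with an operation defined in a neighbourhood of $(e,e)$ satisfying the uniform group axioms locally. A group with dilatations $(G,\delta)$ is a local uniform group $G$ with a local action $\delta$ of $\Gamma$ on $G$ (each $\delta_\varepsilon$ maps a neighbourhood of $e$ to a neighbourhood of $e$, $(\varepsilon,x)\mapsto\delta_\varepsilon x$ is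 uniformly continuous, and $\delta_\varepsilon\delta_\mu^{-1}=\delta_{\varepsilon\mu^{-1}}$ near $e$) such that: H0. $\lim_{\varepsilon\to0}\delta_\varepsilon x=e$ uniformly for $x$ in a compact neighbourhood of $e$; H1. $\beta(x,y)=\lim_{\varepsilon\to0}\delta_\varepsilon^{-1}((\delta_\varepsilon x)(\delta_\varepsilon y))$ is well defined in a compact neighbourhood of $e$, and the limit is uniform; H2. $\lim_{\varepsilon\to0}\delta_\varepsilon^{-1}((\delta_\varepsilon x)^{-1})=x^{-1}$, the limit existing in a neighbourhood of $e$, uniformly in $x$. A normed group with dilatations $(G,\delta,\|\cdot\|)$ is a group with dilatations with a continuous function $\|\cdot\|:G\to\mathbb R$ such that, locally near $e$: (a) $\|x\|\ge0$, and $\|x\|=0$ implies $x=e$; (b) $\|xy\|\le\|x\|+\|y\|$; (c) $\|x^{-1}\|=\|x\|$; (d) the limit $\lim_{\varepsilon\to0}\frac1{\nu(\varepsilon)}\|\delta_\varepsilon x\|=\|x\|^N$ exists, uniformly for $x$ in compact sets; (e) $\|x\|^N=0$ implies $x=e$. **Associated structure.** On a normed group with dilatations, dilatations based at $x$ are $\delta^x_\varepsilon u=x\,\delta_\varepsilon(x^{-1}u)$ and the distance is $d(x,y)=\|x^{-1}y\|$. The tangent space $T_xG$ is a neighbourhood of $x$ with the operation $\Sigma^x(u,v)=\lim_{\varepsilon\to0}\delta^x_{\varepsilon^{-1}}\delta_\varepsilon^{\delta^x_\varepsilon u}v$ and the dilatations $\delta^x_\varepsilon$; it is a conical group (a local group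 with a local action of $\Gamma$ by morphisms contracting to the neutral element). The same applies to $G^{(2)}$. **Differentiability.** Let $X,Y$ carry such structures $(\delta,d)$, $(\bar\delta,\bar d)$. A continuous $f:X\to Y$ is differentiable at $x$ if there is a conical group morphism $Q^x:T_xX\to T_{f(x)}Y$ (defined near $x$, with $Q^x(\Sigma^x(u,v))=\bar\Sigma^{f(x)}(Q^x(u),Q^x(v))$ and $Q^x(\delta^x_\varepsilon u)=\bar\delta^{f(x)}_\varepsilon Q^x(u)$) such that $\frac1\varepsilon\bar d\big(f(\delta^x_\varepsilon u),\bar\delta^{f(x)}_\varepsilon Q^x(u)\big)\to0$ as $\varepsilon\to0$, uniformly for $u$ in compact sets (close to $x$). $f$ is differentiable if it is so at every point (everything being local, near the neutral element). *)

(* Defs.v *)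
From HB Require Import structures.
From mathcomp Require Import all_boot all_order all_algebra.
From mathcomp Require Import all_classical reals topology normedtype.

Set Implicit Arguments.
Unset Strict Implicit.
Unset Printing Implicit Defensive.
Import Order.TTheory GRing.Theory Num.Theory.
Import numFieldNormedType.Exports.

Local Open Scope classical_set_scope.
Local Open Scope ring_scope.

HB.mixin Record hasContinuousGroupLaw G of Topological G & Group G := {
  mulg_continuous : continuous (fun p : G * G => (p.1 * p.2)%g);
  invg_continuous : continuous (fun x : G => (x^-1)%g)
}.

#[short(type="topologicalGroupType")]
HB.structure Definition TopologicalGroup :=
  {G of Topological G & Group G & hasContinuousGroupLaw G}.

Definition dilatation_parameter (R : realType) (Gam : topologicalGroupType)
    (nu : Gam -> R) : Prop :=
  [/\ hausdorff_space Gam,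
      forall a b : Gam, (a * b = b * a)%g,
      continuous nu &
      [/\ forall a, 0 < nu a,
          forall a b, nu (a * b)%g = nu a * nu b &
          inf (range nu) = 0]].

(* The filter "eps --> 0", i.e. nu eps --> 0. *)
Definition nu0 (R : realType) (Gam : Type) (nu : Gam -> R) : set_system Gam :=
  filter_from [set r : R | 0 < r] (fun r => [set a | nu a < r]).

(* Partially defined maps are option-valued; every equation or estimate below
   that mentions a value [Some _] asserts that the value exists. *)
Notation "'olet' x := a 'in' b" := (obind (fun x => b) a)
  (at level 200, x name, a at level 100, b at level 200).

Definition punif_continuous_on (X Y : uniformType) (D : set X)
    (f : X -> option Y) : Prop :=
  forall E, entourage E -> exists2 A : set (X * X), entourage A &
    forall x x', D x -> D x' -> A (x, x') ->
    forall y y', f x = Some y -> f x' = Some y' -> E (y, y').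

Definition pcontinuous_at (X Y : topologicalType) (f : X -> option Y) (x : X) :
    Prop :=
  exists2 y, f x = Some y &
    forall V, nbhs y V -> \forall x' \near x, exists2 y', f x' = Some y' & V y'.

Definition plim (I : Type) (Y : topologicalType) (F : set_system I)
    (g : I -> option Y) (l : Y) : Prop :=
  forall V, nbhs l V -> \forall i \near F, exists2 y, g i = Some y & V y.

Definition punif_lim (I X : Type) (Y : uniformType) (F : set_system I)
    (K : set X) (g : I -> X -> option Y) (l : X -> Y) : Prop :=
  forall E, entourage E ->
  \forall i \near F, forall x, K x ->
    exists2 y, g i x = Some y & E (l x, y).

(* The operations of a normed local group with dilatations, without axioms. *)
Record dilData (R : realType) (Gam : Type) := DilData {
  carrier :> uniformType;
  neu : carrier;
  lmul : carrier -> carrier -> option carrier;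
  linv : carrier -> option carrier;
  dil : Gam -> carrier -> option carrier;
  nrm : carrier -> R
}.

Arguments neu {R Gam}.
Arguments lmul {R Gam d} : rename.
Arguments linv {R Gam d} : rename.
Arguments dil {R Gam d} : rename.
Arguments nrm {R Gam d} : rename.

Section Structure.
Variables (R : realType) (Gam : topologicalGroupType) (nu : Gam -> R).
Variable G : dilData R Gam.
Local Notation e := (neu G).

(* G^(2) carries the product uniformity. *)
Definition local_uniform_group : Prop :=
  linv e = Some e /\
  exists2 V : set G, nbhs e V &
  [/\ forall x, V x -> lmul e x = Some x /\ lmul x e = Some x,
      forall x, V x -> exists x', [/\ linv x = Some x',
        lmul x x' = Some e & lmul x' x = Some e],
      forall x y z, V x -> V y -> V z -> exists xy yz w,
        [/\ lmul x y = Some xy, lmul y z = Some yz,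
            lmul xy z = Some w & lmul x yz = Some w] &
      [/\ punif_continuous_on (V `*` V) (fun p : G * G => lmul p.1 p.2),
          punif_continuous_on V (fun x : G => Some (x, e)) &
          punif_continuous_on V (fun x : G => omap (pair x) (linv x))]].

(* The law dil a \o (dil b)^-1 = dil (a b^-1) is required on one neighbourhood
   U of e, the same for all a and b, wherever both sides are defined. Uniform
   continuity in (a, x) is with respect to the group uniformity of Gam,
   locally in a: already for the homotheties of the real line it fails on all
   of Gam at once. *)
Definition local_action : Prop :=
  (forall a : Gam, (\forall x \near e, exists y, dil a x = Some y) /\
     nbhs e [set y : G | exists x, dil a x = Some y]) /\
  exists2 U : set G, nbhs e U &
  [/\ forall x, U x -> dil 1%g x = Some x,
      forall (a b : Gam) x y z z', U x -> U y ->
        dil b x = Some y -> dil a x = Some z ->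
        dil (a * b^-1)%g y = Some z' -> z' = z &
      forall a0 : Gam, exists2 W : set Gam, nbhs a0 W &
        forall E : set (G * G), entourage E ->
        exists N : set Gam, exists A : set (G * G),
        [/\ nbhs (1%g : Gam) N, entourage A &
          forall a a' x x', W a -> W a' -> N (a^-1 * a')%g ->
            U x -> U x' -> A (x, x') ->
          forall y y', dil a x = Some y -> dil a' x' = Some y' -> E (y, y')]].

Definition group_with_dilatations : Prop :=
  [/\ local_uniform_group, local_action &
  [/\ exists2 K : set G, nbhs e K /\ compact K &
        punif_lim (nu0 nu) K dil (fun=> e),
      exists2 K : set G, nbhs e K /\ compact K &
        exists beta : G * G -> G,
        punif_lim (nu0 nu) (K `*` K) (fun a (p : G * G) =>
          olet x := dil a p.1 in olet y := dil a p.2 in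
          olet z := lmul x y in dil (a^-1)%g z) beta &
      exists2 K : set G, nbhs e K &
        exists2 i : G -> G, (forall x, K x -> linv x = Some (i x)) &
        punif_lim (nu0 nu) K (fun a x =>
          olet y := dil a x in olet z := linv y in dil (a^-1)%g z) i]].

Definition normed_group_with_dilatations : Prop :=
  [/\ group_with_dilatations,
      continuous (@nrm R Gam G) &
      exists2 U : set G, nbhs e U &
      [/\ forall x, U x -> 0 <= nrm x /\ (nrm x = 0 -> x = e),
          forall x y z, U x -> U y -> lmul x y = Some z ->
            nrm z <= nrm x + nrm y,
          forall x y, U x -> linv x = Some y -> nrm y = nrm x &
          exists nrmN : G -> R,
            (forall K : set G, K `<=` U -> compact K ->
               punif_lim (nu0 nu) K
                 (fun a x => omap (fun y => nrm y / nu a) (dil a x)) nrmN) /\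
            (forall x, U x -> nrmN x = 0 -> x = e)]].

Definition ldist (x y : G) : option R :=
  olet x' := linv x in omap nrm (lmul x' y).

Definition bdil (x : G) (a : Gam) (u : G) : option G :=
  olet x' := linv x in olet v := lmul x' u in olet w := dil a v in lmul x w.

(* [is_Sigma x u v s] : the tangent operation Sigma^x(u, v) exists and is s. *)
Definition is_Sigma (x u v s : G) : Prop :=
  plim (nu0 nu) (fun a =>
    olet p := bdil x a u in olet q := bdil p a v in bdil x (a^-1)%g q) s.

End Structure.

(* The inverse of (x, u) for (x, u)(y, v) = (xy, y^-1 u y v) is
   (x^-1, x u^-1 x^-1). When G is not commutative the norm of the double is in
   general not subadditive, nor invariant under inversion, so the double need
   not satisfy [normed_group_with_dilatations]; the based dilatations, the
   distance and the tangent operation only use the data. *)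
Definition double_group (R : realType) (Gam : Type) (G : dilData R Gam) :
    dilData R Gam :=
  @DilData R Gam (G * G)%type (neu G, neu G)
    (fun p q => olet xy := lmul p.1 q.1 in olet y' := linv q.1 in
                olet s := lmul y' p.2 in olet t := lmul s q.1 in
                olet w := lmul t q.2 in Some (xy, w))
    (fun p => olet x' := linv p.1 in olet u' := linv p.2 in
              olet s := lmul p.1 u' in olet w := lmul s x' in Some (x', w))
    (fun a p => olet x := dil a p.1 in olet y := dil a p.2 in Some (x, y))
    (fun p => Num.max (nrm p.1) (nrm p.2)).

Definition op (R : realType) (Gam : Type) (G : dilData R Gam)
  (p : double_group G) : option G := lmul p.1 p.2.

Section Differentiability.
Variables (R : realType) (Gam : topologicalGroupType) (nu : Gam -> R).
Variables X Y : dilData R Gam.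

(* Q and its equations are meant near x: for each a, the commutation
   with the dilatations of coefficient a is on a neighbourhood of x that may
   depend on a, but a single neighbourhood suffices for all a close to 0. *)
Definition conical_morphism_near (Q : X -> Y) (x : X) (y : Y) : Prop :=
  let commutes a u := exists2 u', bdil x a u = Some u' &
                        bdil y a (Q u) = Some (Q u') in
  [/\ exists2 U : set X, nbhs x U & forall u v, U u -> U v ->
        exists2 s, is_Sigma nu x u v s & is_Sigma nu y (Q u) (Q v) (Q s),
      forall a : Gam, \forall u \near x, commutes a u &
      exists2 U : set X, nbhs x U &
        \forall a \near nu0 nu, forall u, U u -> commutes a u].

Definition dil_differentiable_at (f : X -> option Y) (x : X) : Prop :=
  exists2 y, f x = Some y &
  exists2 Q : X -> Y, conical_morphism_near Q x y &
  exists2 U : set X, nbhs x U &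
  forall K : set X, K `<=` U -> compact K ->
    punif_lim (nu0 nu) K (fun a u =>
      olet p := bdil x a u in olet fp := f p in
      olet q := bdil y a (Q u) in
      omap (fun r : R => r / nu a) (ldist fp q)) (fun=> 0).

Definition dil_differentiable (f : X -> option Y) : Prop :=
  \forall x \near neu X, pcontinuous_at f x /\ dil_differentiable_at f x.

End Differentiability.

(* Main.v *)
Require Import Defs.
From mathcomp Require Import all_boot all_order all_algebra.
From mathcomp Require Import zify.
From mathcomp Require Import all_classical reals topology normedtype.

(* Write D for the double group. The map [op : D -> G] is a morphism of groups:
   op ((x,u)(y,v)) = x y (y^-1 u y) v = (x u)(y v). Hence, for a base point X
   and (p, w) := X^-1 u, applying [op] to the dilated point gives
   op X * delta_a p * delta_a w, which agrees to first order with
   op X * delta_a (beta (p, w)); so Q u := op X * beta (X^-1 u) is the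
   differential. Its error is the norm of a product of the form
   (delta_a p * delta_a w)^-1 * delta_a (beta (p, w)), which is delta_a z_a with
   z_a --> beta (beta^-1, beta) = e, so after division by nu a it tends to the
   asymptotic norm of e, namely 0. That Q is a morphism follows from the group
   identity expressing that [op] is a morphism, applied to delta_a's, since
   Sigma^x (u, v) = x * beta (x^-1 u, x^-1 v) in G and in D. *)

Set Implicit Arguments.
Unset Strict Implicit.
Unset Printing Implicit Defensive.
Import Order.TTheory GRing.Theory Num.Theory.
Import numFieldNormedType.Exports.

Local Open Scope classical_set_scope.
Local Open Scope ring_scope.

(** Every operation is partial, every law holds only near [e], and neither separation of [G] nor the
    equation [dil a e = Some e] is assumed. The missing facts come from the asymptotic norm [N]:
    near [e] it is continuous, homogeneous and vanishes only at [e], which forces dilatations to fix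
    [e] and limits near [e] to be unique. First-order statements are carried by [tends]: the points
    [X_a] equal [delta_a x_a] with [x_a] converging to [l]. Letting [x_a] vary with [a] is
    essential, since the base point moves inside [Sigma^x]; H1 and H2, being uniform, make the
    relation stable under products and inverses. The norm of the double may fail to be subadditive,
    so the double is not an instance of the same axioms; hence the norm-free interface [dil_chain],
    valid for both groups, from which the tangent operation is computed once. *)

Section TotalOperations.
Variables (R : realType) (Gam : Type) (G : dilData R Gam).

(** Completion by [neu G] lets the operations appear in filter limits and in rewriting; the value is
    meaningful only beside an equation such as [rn_mul]. *)
Definition tmul (x y : G) : G := odflt (neu G) (lmul x y).
Definition tinv (x : G) : G := odflt (neu G) (linv x).
Definition tdil (a : Gam) (x : G) : G := odflt (neu G) (dil a x).

End TotalOperations.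

(** * A neighbourhood on which all the axioms hold together *)

Section RegularNeighbourhood.
Variables (R : realType) (Gam : topologicalGroupType) (nu : Gam -> R).
Variable G : dilData R Gam.
Local Notation e := (neu G).

(** [O] need not be stable under the operations: laws and continuity are stated at arguments in [O]
    only, and stability is regained later by shrinking. *)
Record regular_nbhd (O : set G) (beta : G * G -> G) (N : G -> R) : Prop :=
  RegularNbhd {
  rn_open : open O;
  rn_neu : O e;
  rn_mul : forall x y, O x -> O y -> lmul x y = Some (tmul x y);
  rn_mulA : forall x y z, O x -> O y -> O z ->
    tmul (tmul x y) z = tmul x (tmul y z);
  rn_mul1 : forall x, O x -> tmul e x = x /\ tmul x e = x;
  rn_inv : forall x, O x -> linv x = Some (tinv x);
  rn_mulV : forall x, O x -> tmul (tinv x) x = e /\ tmul x (tinv x) = e;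
  rn_inv_neu : tinv e = e;
  rn_mul_cont : forall x y, O x -> O y ->
    (fun p : G * G => tmul p.1 p.2) @ (x, y) --> tmul x y;
  rn_inv_cont : forall x, O x -> @tinv R Gam G @ x --> tinv x;
  rn_dil1 : forall x, O x -> dil 1%g x = Some x;
  rn_dilD : forall (a b : Gam) x y z z', O x -> O y ->
        dil b x = Some y -> dil a x = Some z ->
        dil (a * b^-1)%g y = Some z' -> z' = z;
  rn_dil_near : forall a : Gam, \forall x \near e, exists y, dil a x = Some y;
  rn_dil_cont : forall (a : Gam) x, O x -> forall E, entourage E ->
    \forall x' \near x, forall y y',
      dil a x = Some y -> dil a x' = Some y' -> E (y, y');
  rn_dil_lim : punif_lim (nu0 nu) O dil (fun=> e);
  rn_beta_lim : punif_lim (nu0 nu) (O `*` O) (fun a (p : G * G) =>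
          olet x := dil a p.1 in olet y := dil a p.2 in
          olet z := lmul x y in dil (a^-1)%g z) beta;
  rn_inv_lim : punif_lim (nu0 nu) O (fun a x =>
        olet y := dil a x in olet z := linv y in dil (a^-1)%g z)
        (@tinv R Gam G);
  rn_nrm_cont : continuous (@nrm R Gam G);
  rn_N_lim : punif_lim (nu0 nu) O
    (fun a x => omap (fun y => nrm y / nu a) (dil a x)) N;
  rn_N0 : forall x, O x -> N x = 0 -> x = e }.

Lemma punif_limS (I X : Type) (Y : uniformType) (F : set_system I)
    (K K' : set X) (g : I -> X -> option Y) (l : X -> Y) :
  Filter F -> K' `<=` K -> punif_lim F K g l -> punif_lim F K' g l.
Proof.
move=> FF sK gl E /gl; apply: filterS => i gi x /sK; exact: gi.
Qed.

Lemma punif_lim_ext (I X : Type) (Y : uniformType) (F : set_system I)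
    (K : set X) (g : I -> X -> option Y) (l l' : X -> Y) :
  Filter F -> {in K, l =1 l'} -> punif_lim F K g l -> punif_lim F K g l'.
Proof.
move=> FF ll' gl E /gl; apply: filterS => i gi x Kx.
by rewrite -ll' ?inE//; exact: gi.
Qed.

Lemma punif_continuous_at (X Y : uniformType) (D : set X) (f : X -> option Y)
    x E : punif_continuous_on D f -> nbhs x D -> entourage E ->
  \forall x' \near x, forall y y', f x = Some y -> f x' = Some y' -> E (y, y').
Proof.
move=> fc Dx entE; have [A entA fA] := fc _ entE.
have Dx0 := nbhs_singleton Dx.
near=> x' => y y'; apply: fA => //; first exact: (near Dx x').
by apply/xsectionP; near: x'; exact: nbhs_entourage.
Unshelve. all: by end_near. Qed.

(** Uniform spaces are regular: the closure of the [split_ent E]-ball at [x] lies in its [E]-ball,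
    and cutting [K] by a closed set keeps it compact. This fits a compact neighbourhood inside the
    set where the norm axioms hold, the norm limit being uniform on compact sets. *)
Lemma compact_nbhs_sub (T : uniformType) (x : T) (K U : set T) :
  nbhs x K -> compact K -> nbhs x U ->
  exists C, [/\ nbhs x C, compact C & C `<=` U].
Proof.
move=> Kx cK /nbhsP[E entE sEU].
exists (K `&` closure (xsection (split_ent E) x)); split.
- apply: filterI => //; apply: filterS (@subset_closure _ _) _.
  exact: nbhs_entourage.
- exact: compact_closedI cK (@closed_closure _ _).
- by move=> y [_ /(ent_closure entE)]; exact: sEU.
Qed.

Lemma nu0_filter : Filter (nu0 nu).
Proof.
apply: filter_from_filter; first by exists 1 => /=.
move=> r s /= r0 s0; exists (Num.min r s); first by rewrite /= lt_min r0.
by move=> a /=; rewrite lt_min => /andP[].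
Qed.

Lemma exists_regular_nbhd : normed_group_with_dilatations nu G ->
  exists O beta N, regular_nbhd O beta N.
Proof.
have FF := nu0_filter.
move=> [[[inve [V Ve [V1 VV VA [Vm _ Vi]]]] [da [U Ue [U1 Ulaw Uc]]]
  [[K0 [K0e cK0] lim0] [K1 [K1e _] [beta lim1]] [K2 K2e [i iE lim2]]]]
  nc [W We [_ _ _ [N [WN WN0]]]]].
have [C [Ce cC CW]] := compact_nbhs_sub K0e cK0 We.
pose O := (V `&` U `&` K0 `&` K1 `&` K2 `&` C)°.
have Oe : O e.
  apply: nbhs_singleton; apply: nbhs_interior.
  by do ![apply: filterI => //].
have OS x : O x ->
    [/\ [/\ nbhs x V, V x & V x], nbhs x U, K0 x, K1 x & K2 x /\ C x].
  move=> Ox; have := nbhs_singleton Ox => -[] [] [] [] [] ? ? ? ? ? ?.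
  split=> //; [split=> // | ]; move: Ox; rewrite /O /interior/=;
  by apply: filterS => y [] [] [] [] [].
have OV x : O x -> V x by case/OS => -[].
have OU x : O x -> U x by case/OS => _ /nbhs_singleton.
have OK0 x : O x -> K0 x by case/OS.
have OK1 x : O x -> K1 x by case/OS.
have OK2 x : O x -> K2 x by case/OS => _ _ _ _ [].
have OC x : O x -> C x by case/OS => _ _ _ _ [].
(* Associativity with third factor [e] contains the existence of the product of two points. *)
have Vlmul x y : V x -> V y -> lmul x y = Some (tmul x y).
  move=> Vx Vy; have [xy [yz [w []]]] := VA _ _ _ Vx Vy (nbhs_singleton Ve).
  by rewrite /tmul => ->.
exists O, beta, N; split => //.
- exact: open_interior.
- by move=> x y /OV Vx /OV; exact: Vlmul.
- move=> x y z /OV Vx /OV Vy /OV Vz.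
  have [xy [yz [w [+ + + +]]]] := VA _ _ _ Vx Vy Vz.
  by rewrite /tmul => -> -> /= -> ->.
- by move=> x /OV /V1; rewrite /tmul => -[-> ->].
- by move=> x /OV /VV[x' [+ _ _]]; rewrite /tinv => ->.
- by move=> x /OV /VV[x' []]; rewrite /tinv /tmul => -> /= -> ->.
- by rewrite /tinv inve.
- move=> x y Ox Oy; apply/cvg_entourageP => E entE.
  have [[nVx Vx _] _ _ _ _] := OS _ Ox; have [[nVy Vy _] _ _ _ _] := OS _ Oy.
  have VVn : nbhs (x, y) (V `*` V) by exists (V, V).
  have := punif_continuous_at Vm VVn entE.
  rewrite !near_simpl; apply: filter_app; near=> p; apply => /=.
    exact: Vlmul.
  by have [] := near VVn p => // ? ?; exact: Vlmul.
- move=> x Ox; have [[nVx Vx _] _ _ _ _] := OS _ Ox.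
  apply/cvg_entourageP => E entE.
  (* Ignoring the first coordinates extracts the continuity of inversion from that of [i'']. *)
  have entE' : entourage [set p : (G * G) * (G * G) | E (p.1.2, p.2.2)].
    exists (setT, E) => /=; first by split => //; exact: entourageT.
    by move=> [[x1 y1] [x2 y2]] /= [_ Ey]; exists ((x1, x2), (y1, y2)).
  have := punif_continuous_at Vi nVx entE'.
  rewrite !near_simpl; apply: filter_app; near=> y => /= H.
  have Vy : V y by exact: (near nVx).
  apply: (H (x, tinv x) (y, tinv y)); rewrite /tinv.
    by have [? [->]] := VV _ Vx.
  by have [? [->]] := VV _ Vy.
- by move=> x /OU /U1.
- by move=> a b x y z z' /OU Ux /OU; exact: Ulaw.
- by move=> a; have [] := da a.
- move=> a x Ox E entE; have [_ nUx _ _ _] := OS _ Ox.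
  (* For a fixed coefficient the quotient [a^-1 * a] is 1, so joint uniform continuity specialises
     to continuity in [x]. *)
  have Uac : punif_continuous_on U (dil a).
    move=> E' /= entE'; have [B Ba UB] := Uc a.
    have [M [A [M1 entA MA]]] := UB _ entE'; exists A => // y y' Uy Uy' Ayy'.
    apply: MA => //; [exact: nbhs_singleton.. | ].
    by rewrite mulVg; exact: nbhs_singleton.
  exact: punif_continuous_at Uac nUx entE.
- exact: (punif_limS _ OK0 lim0).
- by apply: (punif_limS _ _ lim1) => -[x y] [/= /OK1 ? /OK1].
- apply: (punif_lim_ext _ _ (punif_limS _ OK2 lim2)) => x.
  by rewrite inE /tinv => /OK2 /iE ->.
- exact: (punif_limS _ OC (WN _ CW cC)).
- by move=> x /OC /CW; exact: WN0.
Unshelve. all: by end_near. Qed.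

End RegularNeighbourhood.

(** The usual three-entourage argument. As the maps are partial, their continuity at [x] means
    closeness of whatever values exist, and is asked only for indices near [F]. *)
Lemma punif_lim_cvg (I : Type) (X : topologicalType) (Y : uniformType)
    (F : set_system I) {FF : ProperFilter F} (K : set X)
    (g : I -> X -> option Y) (l : X -> Y) x :
  nbhs x K -> punif_lim F K g l ->
  (\forall i \near F, forall E, entourage E -> \forall x' \near x,
    forall y y', g i x = Some y -> g i x' = Some y' -> E (y, y')) ->
  l @ x --> l x.
Proof.
move=> Kx gl gc; apply/cvg_entourageP => E entE; rewrite near_simpl.
have Kx0 := nbhs_singleton Kx.
have entE1 : entourage (split_ent E) by [].
have entE2 : entourage (split_ent (split_ent E)) by [].
have entE3 := entourage_invI entE2.
have [i [gi gci]] := filter_ex (filterI (gl _ entE3) gc).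
have [y gy [ly _]] := gi _ Kx0.
near=> x'; have Kx' : K x' by exact: (near Kx).
have [y' gy' [_ ly']] := gi _ Kx'.
apply: (entourage_split y') => //; last exact: split_ent_subset.
apply: (entourage_split y) => //.
by move: (y) (y') gy gy'; near: x'; exact: gci.
Unshelve. all: by end_near. Qed.

(** * The filter of small parameters *)

Section DilatationParameter.
Variables (R : realType) (Gam : topologicalGroupType) (nu : Gam -> R).
Hypothesis hnu : dilatation_parameter nu.

Lemma nu_gt0 a : 0 < nu a. Proof. by have [_ _ _ []] := hnu. Qed.

Lemma nuM a b : nu (a * b)%g = nu a * nu b.
Proof. by have [_ _ _ []] := hnu. Qed.

Lemma nu0_proper : ProperFilter (nu0 nu).
Proof.
apply: (Build_ProperFilter_ex _ (nu0_filter nu)) => A [r /= r0 rA].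
have [_ _ _ [_ _ inf0]] := hnu.
have [||_ [a _ <-] ar] := @inf_lt _ (range nu) r; last by exists a; exact: rA.
  by exists (nu 1%g), 1%g.
by rewrite inf0.
Qed.

(** A fixed factor only rescales the bound on [nu]. Reindexing by [b * a] is what turns one
    dilatation into a change of scale. *)
Lemma nu0_mulr (P : set Gam) a :
  (\forall b \near nu0 nu, P b) -> \forall b \near nu0 nu, P (b * a)%g.
Proof.
move=> [r /= r0 rP]; exists (r / nu a) => /=; first by rewrite divr_gt0 ?nu_gt0.
by move=> b /=; rewrite ltr_pdivlMr ?nu_gt0// -nuM; exact: rP.
Qed.

End DilatationParameter.

(** * Continuity of the asymptotic norm and of [beta] *)

Section Limits.
Variables (R : realType) (Gam : topologicalGroupType) (nu : Gam -> R).
Hypothesis hnu : dilatation_parameter nu.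
Variable G : dilData R Gam.
Local Notation e := (neu G).
Variables (O : set G) (beta : G * G -> G) (N : G -> R).
Hypothesis rO : regular_nbhd nu O beta N.
Local Notation F0 := (nu0 nu).
Local Existing Instance nu0_filter.

Let F0_proper : ProperFilter F0 := nu0_proper hnu.
Local Existing Instance F0_proper.

Lemma rn_nbhs x : O x -> nbhs x O.
Proof. by move=> Ox; apply: open_nbhs_nbhs; split => //; exact: rn_open rO. Qed.

Lemma dil_near0 (W : set G) : nbhs e W ->
  \forall a \near F0, forall x, O x ->
    dil a x = Some (tdil a x) /\ W (tdil a x).
Proof.
move=> /nbhsP[E entE sEW]; have := rn_dil_lim rO entE.
apply: filterS => a aO x /aO[y]; rewrite /tdil => -> Ey; split => //=.
exact/sEW/xsectionP.
Qed.

Lemma tdil_cvg a x : O x -> (\forall x' \near x, exists y, dil a x' = Some y) ->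
  tdil a @ x --> tdil a x.
Proof.
move=> Ox dx; apply/cvg_entourageP => E entE; rewrite near_simpl.
have [y0 dxy] := nbhs_singleton dx.
have := rn_dil_cont rO a Ox entE; apply: filter_app.
near=> x'; have [y dy] : exists y, dil a x' = Some y by near: x'.
by apply; rewrite /tdil ?dxy ?dy.
Unshelve. all: by end_near. Qed.

Lemma tmul_cvg I (F : set_system I) {FF : Filter F} (x y : I -> G) x0 y0 :
  O x0 -> O y0 -> x @ F --> x0 -> y @ F --> y0 ->
  (fun i => tmul (x i) (y i)) @ F --> tmul x0 y0.
Proof.
move=> Ox Oy xx yy.
apply: (@cvg_comp _ _ _ (fun i => (x i, y i)) (fun p => tmul p.1 p.2)).
  exact: cvg_pair xx yy.
exact: (rn_mul_cont rO Ox Oy).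
Qed.

Lemma tinv_cvg I (F : set_system I) {FF : Filter F} (x : I -> G) x0 :
  O x0 -> x @ F --> x0 -> (fun i => tinv (x i)) @ F --> tinv x0.
Proof.
move=> Ox xx; apply: cvg_comp xx _; exact: (rn_inv_cont rO Ox).
Qed.

Lemma N_cont x : O x -> N @ x --> N x.
Proof.
move=> Ox; apply: (punif_lim_cvg (F := F0) (rn_nbhs Ox) (rn_N_lim rO)).
have := dil_near0 (@filterT _ _ (nbhs_filter e)); apply: filterS => a aO E entE.
have dx : \forall x' \near x, exists y, dil a x' = Some y.
  by apply: filterS (rn_nbhs Ox) => x' /aO[-> _]; exists (tdil a x').
have /cvg_entourage/(_ E entE) :
    (fun x' => nrm (tdil a x') / nu a) @ x --> nrm (tdil a x) / nu a.
  apply: cvgM (cvg_cst _); apply: (cvg_comp (tdil a) (@nrm R Gam G)).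
    exact: tdil_cvg.
  exact: (rn_nrm_cont rO).
rewrite near_simpl; apply: filter_app; near=> x' => Ex' y y'.
have Ox' : O x' by near: x'; exact: rn_nbhs.
by rewrite (aO _ Ox).1 (aO _ Ox').1 => -[<-] [<-].
Unshelve. all: by end_near. Qed.

Lemma nbhs_mul11 (W : set G) : nbhs e W -> exists A : set G,
  nbhs e A /\ forall x y, A x -> A y -> W (tmul x y).
Proof.
have Oe := rn_neu rO; move=> We.
have ee : tmul e e = e by have [] := rn_mul1 rO Oe.
have := rn_mul_cont rO Oe Oe; rewrite ee => /(_ _ We)[[A B] /= [Ae Be] AB].
exists (A `&` B); split; first exact: filterI.
by move=> x y [Ax _] [_ By]; apply: (AB (x, y)).
Qed.

Lemma beta_near0 : \forall a \near F0, forall x y, O x -> O y ->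
  [/\ O (tdil a x), O (tdil a y), O (tmul (tdil a x) (tdil a y)) &
  dil a^-1%g (tmul (tdil a x) (tdil a y)) =
  Some (tdil a^-1%g (tmul (tdil a x) (tdil a y)))].
Proof.
have nO := rn_nbhs (rn_neu rO).
have [A [Ae AO]] := nbhs_mul11 nO.
have OAe : nbhs e (O `&` A) by exact: filterI.
(* [entourageT] discards the estimate of H1 and keeps only that [dil a^-1] is defined at the
   product. *)
have := dil_near0 OAe; have := rn_beta_lim rO entourageT.
apply: filterS2 => a a1 a2 x y Ox Oy.
have [dx [Odx Ax]] := a2 _ Ox; have [dy [Ody Ay]] := a2 _ Oy.
split=> //; first exact: AO.
have [z + _] := a1 (x, y) (conj Ox Oy).
by rewrite /= dx dy /= (rn_mul rO)//= /tdil => ->.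
Qed.

(** For small [a] the product of the dilated points falls back into [O], where [dil a^-1] is
    continuous; so [beta] is a uniform limit of maps continuous at [(x, y)]. *)
Lemma beta_cont x y : O x -> O y -> beta @ (x, y) --> beta (x, y).
Proof.
move=> Ox Oy.
apply: (punif_lim_cvg (F := F0) _ (rn_beta_lim rO)).
  by exists (O, O) => //=; split; exact: rn_nbhs.
have := beta_near0; have := dil_near0 (@filterT _ _ (nbhs_filter e)).
apply: filterS2 => a aO aM E entE.
have dx z : O z -> \forall x' \near z, exists y, dil a x' = Some y.
  move=> Oz.
  by apply: filterS (rn_nbhs Oz) => x' /aO[-> _]; exists (tdil a x').
have [Odx Ody Om _] := aM _ _ Ox Oy.
have mc : (fun p : G * G => tmul (tdil a p.1) (tdil a p.2)) @ (x, y) -->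
    tmul (tdil a x) (tdil a y).
  apply: tmul_cvg => //.
    apply: (cvg_comp fst (tdil a)); first exact: cvg_fst.
    exact: tdil_cvg Ox (dx _ Ox).
  apply: (cvg_comp snd (tdil a)); first exact: cvg_snd.
  exact: tdil_cvg Oy (dx _ Oy).
have mE := mc _ (rn_dil_cont rO a^-1%g Om entE).
near=> p => z z' /=.
have Op : (O `*` O) p.
  by near: p; exists (O, O) => //=; split; exact: rn_nbhs.
have [Op1 Op2] := Op.
have [? ? ? _] := aM _ _ Op1 Op2.
rewrite !(aO _ _).1//= !(rn_mul rO)//=.
by move: (z) (z'); near: p; exact: mE.
Unshelve. all: by end_near. Qed.

End Limits.

(** * Limits at a given scale *)

(* [l] is the first-order part of [X] at the scale [al]. *)
Definition tends (R : realType) (Gam : Type) (G : dilData R Gam)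
    (I : Type) (F : set_system I) (al : I -> Gam) (X : I -> G) (l : G) :=
  forall W, nbhs l W ->
    \forall i \near F, exists2 x, W x & dil (al i) x = Some (X i).

Section Tends.
Variables (R : realType) (Gam : topologicalGroupType) (nu : Gam -> R).
Hypothesis hnu : dilatation_parameter nu.
Variable G : dilData R Gam.
Local Notation e := (neu G).
Variables (O : set G) (beta : G * G -> G) (N : G -> R).
Hypothesis rO : regular_nbhd nu O beta N.
Local Notation F0 := (nu0 nu).
Local Existing Instance nu0_filter.

Let F0_proper : ProperFilter F0 := nu0_proper hnu.
Local Existing Instance F0_proper.

Let nO x : O x -> nbhs x O := rn_nbhs rO (x := x).
Let Oe : O e := rn_neu rO.
Let nIO x W : nbhs x W -> O x -> nbhs x (W `&` O).
Proof. by move=> xW /nO; exact: filterI. Qed.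

Lemma dil_defined0 : \forall a \near F0, forall x, O x ->
  dil a x = Some (tdil a x).
Proof. by apply: filterS (dil_near0 rO (nO Oe)) => a aO x /aO[]. Qed.

Lemma dil_comp a b x y z z' : O x -> O y -> dil b x = Some y ->
  dil (a * b)%g x = Some z -> dil a y = Some z' -> z' = z.
Proof.
move=> Ox Oy bx abx ay; apply: (rn_dilD rO Ox Oy bx abx).
by rewrite mulgK.
Qed.

Lemma dil_inv a x y z : O x -> O y -> dil a x = Some y ->
  dil a^-1%g y = Some z -> z = x.
Proof.
move=> Ox Oy ax ay; apply: (rn_dilD rO Ox Oy ax (rn_dil1 rO Ox)).
by rewrite mul1g.
Qed.

Lemma nu_cvg0 : nu @ F0 --> (0 : R).
Proof.
apply/cvgrPdist_lt => eps eps0; exists eps => // a /= na.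
by rewrite sub0r normrN gtr0_norm// (nu_gt0 hnu).
Qed.

Lemma nrm_dil_cvg x : O x -> (fun a => nrm (tdil a x) / nu a) @ F0 --> N x.
Proof.
move=> Ox; apply/cvg_entourageP => E entE; rewrite near_simpl.
apply: filterS2 dil_defined0 (rn_N_lim rO entE) => a /(_ _ Ox) + /(_ _ Ox)[r].
by move=> -> /= [<-].
Qed.

(** The quotient of the norm of [delta_(a b) x] by [nu a] is [nu b] times its quotient by
    [nu (a * b)], and [a * b] tends to 0 with [a]. *)
Lemma N_dil b x : O x -> dil b x = Some (tdil b x) -> O (tdil b x) ->
  N (tdil b x) = nu b * N x.
Proof.
move=> Ox bx Obx.
have cN := nrm_dil_cvg Obx; apply: (cvg_unique _ cN) => //.
have cNx : (fun a => nrm (tdil (a * b)%g x) / nu (a * b)%g) @ F0 --> N x.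
  apply: (@cvg_comp _ _ _ (fun a => (a * b)%g) (fun a => nrm (tdil a x) / nu a)
    F0 F0); last exact: nrm_dil_cvg.
  by move=> P; exact: nu0_mulr.
rewrite mulrC; apply: cvg_trans (cvgM cNx (cvg_cst (nu b))).
apply: near_eq_cvg; near=> a.
have -> : tdil a (tdil b x) = tdil (a * b)%g x.
  apply: (dil_comp Ox Obx bx).
    by move: (x) Ox {bx Obx cN cNx}; near: a; exact: nu0_mulr dil_defined0.
  by move: (tdil b x) Obx {bx cN}; near: a; exact: dil_defined0.
rewrite /= (nuM hnu) invfM mulrA divfK//.
by rewrite gt_eqF// (nu_gt0 hnu).
Unshelve. all: by end_near. Qed.

Lemma tdil_neu_cvg : (fun a => tdil a e) @ F0 --> e.
Proof. by move=> W /(dil_near0 rO); apply: filterS => a /(_ _ Oe)[]. Qed.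

Lemma dil_neu_near : \forall a \near F0,
  dil a e = Some (tdil a e) /\ O (tdil a e).
Proof. by apply: filterS (dil_near0 rO (nO Oe)) => a /(_ _ Oe). Qed.

(** [N (delta_a e)] tends to [N e] by continuity, and to 0 by homogeneity, being [nu a * N e]. *)
Lemma N_neu : N e = 0.
Proof.
have c1 : (fun a => N (tdil a e)) @ F0 --> N e.
  by apply: cvg_comp tdil_neu_cvg _; exact: (N_cont hnu rO Oe).
apply: (cvg_unique _ c1) => //.
rewrite -(mul0r (N e)); apply: cvg_trans (cvgM nu_cvg0 (cvg_cst (N e))).
apply: near_eq_cvg; apply: filterS dil_neu_near => a [ae Oa].
by rewrite N_dil.
Qed.

(* Dilatations are not assumed to fix [e]; they do because [N] is homogeneous
   and vanishes only at [e]. *)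
Lemma dil_neu a : dil a e = Some e.
Proof.
have near_e : \forall b \near F0, dil b e = Some e.
  apply: filterS dil_neu_near => b [be Ob]; rewrite be; congr Some.
  by apply: (rn_N0 rO Ob); rewrite N_dil// N_neu mulr0.
have [b [be abe]] := filter_ex (filterI near_e (nu0_mulr hnu a near_e)).
have [y ay] := nbhs_singleton (rn_dil_near rO a); rewrite ay; congr Some.
apply: (dil_comp Oe Oe be _ ay); rewrite -[RHS]abe.
by have [_ -> _ _] := hnu.
Qed.

(* [G] is not assumed to be Hausdorff; near [e], points are separated by [N]. *)
Lemma rn_unique I (F : set_system I) {FF : ProperFilter F} (f : I -> G) x y :
  O x -> O y -> O (tinv x) -> O (tmul (tinv x) y) ->
  f @ F --> x -> f @ F --> y -> x = y.
Proof.
move=> Ox Oy Ox' Oz fx fy.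
have [x'x xx'] := rn_mulV rO Ox.
have c y' : O y' -> O (tmul (tinv x) y') -> f @ F --> y' ->
    (fun i => N (tmul (tinv x) (f i))) @ F --> N (tmul (tinv x) y').
  move=> Oy' Oxy' fy'; apply: cvg_comp (N_cont hnu rO Oxy').
  by apply: (tmul_cvg rO) fy' => //; exact: cvg_cst.
have z0 : N (tmul (tinv x) y) = 0.
  rewrite -N_neu -[in RHS]x'x; apply: (cvg_unique _ (c _ Oy Oz fy)) => //.
  by apply: c fx => //; rewrite x'x.
have ze := rn_N0 rO Oz z0.
have [<- _] := rn_mul1 rO Oy.
by rewrite -xx' (rn_mulA rO)// ze; have [_ ->] := rn_mul1 rO Ox.
Qed.

(** Since dilatations fix [e], all approximants of [beta (e, e)] are [e]. So [beta (e, e)] is close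
    to [e] for every entourage; this puts it in [O], where uniqueness of limits is available. *)
Lemma beta_neu : beta (e, e) = e.
Proof.
have [ee _] := rn_mul1 rO Oe.
have close E : entourage E -> E (beta (e, e), e).
  move=> entE; have [a aE] := filter_ex (rn_beta_lim rO entE).
  have [z] := aE (e, e) (conj Oe Oe).
  by rewrite /= !dil_neu /= (rn_mul rO)//= ee dil_neu => -[<-].
have cE : (fun _ : Gam => e) @ F0 --> beta (e, e).
  by apply/cvg_entourageP => E /close EE; rewrite near_simpl; exact: nearW.
have Ob : O (beta (e, e)).
  have /nbhsP[E entE] := nO Oe; apply.
  by apply/xsectionP; exact: (close _ (entourage_inv entE)).
apply/esym; apply: (rn_unique Oe Ob _ _ (@cvg_cst _ e _ F0 _)) => //.
  by rewrite (rn_inv_neu rO).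
by rewrite (rn_inv_neu rO); have [-> _] := rn_mul1 rO Ob.
Qed.

Variables (I : Type) (F : set_system I) (al : I -> Gam).
Context {FF : Filter F}.
Hypothesis al0 : al @ F --> F0.
Local Notation tends := (tends F al).

Let al0P (P : set Gam) : F0 P -> \forall i \near F, P (al i).
Proof. exact: al0. Qed.

(** The index and the scale [al] stay arbitrary because three scales occur: [a] itself, the shifted
    [b * a], and the second projection on pairs of a moving point and a coefficient. *)
Lemma tends_dil (x : I -> G) l : O l -> x @ F --> l ->
  tends (fun i => tdil (al i) (x i)) l.
Proof.
move=> Ol xl W lW.
near=> i; exists (x i); first by near: i; exact: xl.
have Oi : O (x i) by near: i; exact: xl (nO Ol).
by move: (x i) Oi; near: i; exact: al0P dil_defined0.
Unshelve. all: by end_near. Qed.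

Lemma tends_near X l : O l -> tends X l -> \forall i \near F, O (X i).
Proof.
move=> Ol /(_ _ (nO Ol)); have := al0P (dil_near0 rO (nO Oe)).
by apply: filterS2 => i /= ai [x /ai[-> Oi] [<-]].
Qed.

Lemma tends_cvg X l : O l -> tends X l -> X @ F --> e.
Proof.
move=> Ol Xl W eW; rewrite near_simpl.
apply: filterS2 (Xl _ (nO Ol)) (al0P (dil_near0 rO eW)) => i [x Ox ax].
by move=> /(_ _ Ox) /= [+ Wx]; rewrite ax => -[->].
Qed.

(** That [X i] lies in the domain of the inverse dilatation comes from H1 at the pair [(x, e)]: the
    product of the dilated points is [delta_a x], because [e] is fixed. *)
Lemma tends_undil X l : O l -> tends X l ->
  plim F (fun i => dil (al i)^-1%g (X i)) l.
Proof.
move=> Ol Xl W lW.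
have := al0P (beta_near0 rO); have := tends_near Ol Xl.
have := Xl _ (nIO lW Ol).
apply: filterS3 => i [x [Wx Ox] ax] OX /(_ _ _ Ox Oe)[_ _ _].
have [_ Xe] := rn_mul1 rO OX.
rewrite /tdil ax dil_neu /= Xe -/(tdil _ _) => aX; exists x => //.
by rewrite aX; congr Some; exact: dil_inv Ox OX ax aX.
Qed.

(** With the factors written [delta_a x] and [delta_a y], uniformity of H1 gives a [z] close to
    [beta (x, y)], which continuity keeps close to [beta (l, l')]. *)
Lemma tendsM X Y l l' : O l -> O l' -> O (beta (l, l')) ->
  tends X l -> tends Y l' -> tends (fun i => tmul (X i) (Y i)) (beta (l, l')).
Proof.
move=> Ol Ol' Ob Xl Yl' W bW.
have /nbhsP[E entE sE] := nIO bW Ob.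
have := beta_cont hnu rO Ol Ol' (nbhs_entourage _ (entourage_split_ent entE)).
move=> [[A B] /= [lA lB] AB].
have tX := Xl _ (nIO lA Ol); have tY := Yl' _ (nIO lB Ol').
have := al0P (rn_beta_lim rO (entourage_split_ent entE)).
have := al0P (beta_near0 rO); have := al0P dil_defined0.
apply: filter_app3; near=> i => ai bi ci.
have [x [Ax Ox] ax] : exists2 x, (A `&` O) x & dil (al i) x = Some (X i).
  by near: i.
have [y [By Oy] ay] : exists2 y, (B `&` O) y & dil (al i) y = Some (Y i).
  by near: i.
have [z + Ez] := ci (x, y) (conj Ox Oy).
have [] := bi _ _ Ox Oy; rewrite /= /tdil ax ay /= => OX OY OXY _.
rewrite (rn_mul rO)//= => az.
have [Wz Oz] : (W `&` O) z.
  apply/sE/xsectionP; apply: (entourage_split (beta (x, y))) => //.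
  by apply/xsectionP; apply: (AB (x, y)).
(* H1 only says that [dil a^-1] sends the product to [z]; cancelling with [a^-1] in the role of [a]
   yields the value of [dil a z]. *)
exists z => //; rewrite ai//; congr Some.
by apply: (dil_inv OXY Oz az); rewrite invgK ai.
Unshelve. all: by end_near. Qed.

Lemma tends_inv X l : O l -> O (tinv l) ->
  tends X l -> tends (fun i => tinv (X i)) (tinv l).
Proof.
move=> Ol Ol' Xl W lW.
have /nbhsP[E entE sE] := nIO lW Ol'.
have tX := Xl _ (nIO (rn_inv_cont rO Ol
  (nbhs_entourage _ (entourage_split_ent entE))) Ol).
have X'O : \forall i \near F, O (tinv (X i)).
  have := tinv_cvg rO Oe (tends_cvg Ol Xl); rewrite (rn_inv_neu rO).
  by apply; exact: nO.
have OX := tends_near Ol Xl.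
have := al0P (rn_inv_lim rO (entourage_split_ent entE)).
have := al0P dil_defined0.
apply: filter_app2; near=> i => ai ci.
have [x [/= /xsectionP Ax Ox] ax] : exists2 x,
    ((tinv (G:=G) @^-1` xsection (split_ent E) (tinv l)) `&` O) x &
    dil (al i) x = Some (X i).
  by near: i.
have [z + Ez] := ci _ Ox.
rewrite ax /= (rn_inv rO) /=; last by near: i.
move=> az.
have [Wz Oz] : (W `&` O) z.
  by apply/sE/xsectionP; exact: (entourage_split (tinv x)).
exists z => //; rewrite ai//; congr Some.
apply: (dil_inv _ Oz az); first by near: i.
by rewrite invgK ai.
Unshelve. all: by end_near. Qed.

Lemma tends_nrm X l : O l -> tends X l ->
  (fun i => nrm (X i) / nu (al i)) @ F --> N l.
Proof.
move=> Ol Xl; apply/cvg_entourageP => E entE; rewrite near_simpl.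
have lE := N_cont hnu rO Ol (nbhs_entourage _ (entourage_split_ent entE)).
apply: filterS2 (Xl _ (nIO lE Ol))
  (al0P (rn_N_lim rO (entourage_split_ent entE))) => i.
move=> [x [/= /xsectionP Nx Ox] ax] /(_ _ Ox)[r].
by rewrite ax => -[<-]; exact: entourage_split.
Qed.

(** Undoing the dilatations turns both expansions into limits of one family, which [N] separates. *)
Lemma tends_unique {FP : ProperFilter F} X l l' :
  O l -> O l' -> O (tinv l) -> O (tmul (tinv l) l') ->
  tends X l -> tends X l' -> l = l'.
Proof.
move=> Ol Ol' Oi Om Xl Xl'.
have c k : plim F (fun i => dil (al i)^-1%g (X i)) k ->
    (fun i => tdil (al i)^-1%g (X i)) @ F --> k.
  move=> Xk W /Xk; rewrite near_simpl; apply: filterS => i [y Xi Wy].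
  by rewrite /= /tdil Xi.
by apply: (rn_unique Ol Ol' Oi Om (c _ _) (c _ _)); exact: tends_undil.
Qed.

End Tends.

(** * Chains of neighbourhoods and identities in local groups *)

(* Each level of [V] leaves room for one more operation, so that points of
   [V n] can be combined in expressions of depth [n]. *)
Record dil_chain (R : realType) (Gam : topologicalGroupType) (nu : Gam -> R)
    (H : dilData R Gam) (V : nat -> set H) (beta : H * H -> H) : Prop :=
  DilChain {
  dc_open : forall n, open (V n);
  dc_neu : forall n, V n (neu H);
  dc_sub : forall n x, V n.+1 x -> V n x;
  dc_mul : forall x y, V 1 x -> V 1 y -> lmul x y = Some (tmul x y);
  dc_mulS : forall n x y, V n.+1 x -> V n.+1 y -> V n (tmul x y);
  dc_inv : forall x, V 1 x -> linv x = Some (tinv x);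
  dc_invS : forall n x, V n.+1 x -> V n (tinv x);
  dc_mulA : forall x y z, V 2 x -> V 2 y -> V 2 z ->
    tmul (tmul x y) z = tmul x (tmul y z);
  dc_mul1 : forall x, V 1 x -> tmul (neu H) x = x /\ tmul x (neu H) = x;
  dc_mulV : forall x, V 1 x ->
    tmul (tinv x) x = neu H /\ tmul x (tinv x) = neu H;
  dc_mul_cont : forall x y, V 1 x -> V 1 y ->
    (fun p : H * H => tmul p.1 p.2) @ (x, y) --> tmul x y;
  dc_inv_cont : forall x, V 1 x -> @tinv R Gam H @ x --> tinv x;
  dc_beta : forall n x y, V n.+1 x -> V n.+1 y -> V n (beta (x, y));
  dc_dil0 : forall W, nbhs (neu H) W -> \forall a \near nu0 nu,
    forall x, V 0 x -> dil a x = Some (tdil a x) /\ W (tdil a x);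
  dc_undil : forall X l, V 1 l -> tends (nu0 nu) id X l ->
    plim (nu0 nu) (fun a => dil a^-1%g (X a)) l;
  dc_tendsM : forall X Y l l', V 1 l -> V 1 l' ->
    tends (nu0 nu) id X l -> tends (nu0 nu) id Y l' ->
    tends (nu0 nu) id (fun a => tmul (X a) (Y a)) (beta (l, l')) }.

(* Two group expressions with the same reduced word [gnorm] take the same value
   near the neutral element; as [gnorm] computes, this proves identities of free
   groups by reflexivity. *)
Inductive gexp := GOne | GVar of nat | GMul of gexp & gexp | GInv of gexp.

Definition gletter := (bool * nat)%type.

Definition gcons (l : gletter) (w : seq gletter) :=
  if w is l' :: w' then
    if (l.2 == l'.2) && (l.1 != l'.1) then w' else l :: w
  else [:: l].

Definition gcat (w1 w2 : seq gletter) := foldr gcons w2 w1.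

Definition ginv (w : seq gletter) :=
  foldr (fun l v => gcat v [:: (~~ l.1, l.2)]) [::] w.

Fixpoint gnorm (t : gexp) : seq gletter :=
  match t with
  | GOne => [::]
  | GVar i => [:: (false, i)]
  | GMul t1 t2 => gcat (gnorm t1) (gnorm t2)
  | GInv t1 => ginv (gnorm t1)
  end.

(** Only variables count, since neutral elements and inverses do not lengthen the reduced word. *)
Fixpoint gsize (t : gexp) : nat :=
  match t with
  | GOne => 0
  | GVar i => 1
  | GMul t1 t2 => gsize t1 + gsize t2
  | GInv t1 => gsize t1
  end.

Lemma size_gcat w1 w2 : (size (gcat w1 w2) <= size w1 + size w2)%N.
Proof.
elim: w1 => //= l w1; case: (gcat w1 w2) => //= l' w IH.
by case: ifP => _ /=; [exact: ltnW (ltnW _)|].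
Qed.

Lemma size_ginv w : (size (ginv w) <= size w)%N.
Proof.
by elim: w => //= l w IH; rewrite (leq_trans (size_gcat _ _))//= addn1.
Qed.

Lemma size_gnorm t : (size (gnorm t) <= gsize t)%N.
Proof.
elim: t => //= [t1 IH1 t2 IH2|t IH].
  by rewrite (leq_trans (size_gcat _ _))// leq_add.
by rewrite (leq_trans (size_ginv _)).
Qed.

Section ChainGroup.
Variables (R : realType) (Gam : topologicalGroupType) (nu : Gam -> R).
Variables (H : dilData R Gam) (V : nat -> set H) (beta : H * H -> H).
Hypothesis ch : dil_chain nu V beta.
Local Notation e := (neu H).

Lemma dc_le m n x : (m <= n)%N -> V n x -> V m x.
Proof.
by move=> /subnK <-; elim: (n - m)%N => //= k IH /(dc_sub ch)/IH.
Qed.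

Lemma dc_near n x : V n x -> nbhs x (V n).
Proof.
by move=> Vx; apply: open_nbhs_nbhs; split => //; exact: dc_open ch n.
Qed.

Lemma dc_inv_unique x y : V 3 x -> V 3 y -> tmul y x = e -> y = tinv x.
Proof.
move=> Vx Vy yx.
have Vx' := dc_invS ch Vx.
have [_ <-] := dc_mul1 ch (dc_le (isT : (1 <= 3)%N) Vy).
have [_ <-] := dc_mulV ch (dc_le (isT : (1 <= 3)%N) Vx).
rewrite -(dc_mulA ch) ?yx//; do ?exact: dc_sub ch _ _ _.
by have [] := dc_mul1 ch (dc_le (isT : (1 <= 2)%N) Vx').
Qed.

Lemma dc_inv_neu : tinv e = e.
Proof.
have V3 := dc_neu ch 3.
by apply/esym/dc_inv_unique => //; have [] := dc_mul1 ch (dc_neu ch 1).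
Qed.

Lemma dc_invK x : V 4 x -> tinv (tinv x) = x.
Proof.
move=> Vx; apply/esym/dc_inv_unique; first exact: dc_invS ch _ _ Vx.
  exact: (dc_sub ch).
by have [] := dc_mulV ch (dc_le (isT : (1 <= 4)%N) Vx).
Qed.

Lemma dc_invM x y : V 5 x -> V 5 y -> tinv (tmul x y) = tmul (tinv y) (tinv x).
Proof.
move=> Vx Vy; have Vx' := dc_invS ch Vx; have Vy' := dc_invS ch Vy.
have le m z : (m <= 4)%N -> V 5 z -> V m z.
  by move=> m4; apply: dc_le; exact: leq_trans m4 _.
apply/esym/dc_inv_unique.
- by apply: (dc_mulS ch); exact: le.
- exact: (dc_mulS ch).
rewrite (dc_mulA ch) //; [|exact: dc_le Vy'|exact: dc_le Vx'|]; last first.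
  by apply: (dc_mulS ch); exact: le.
rewrite -(dc_mulA ch (dc_le _ Vx'))//; [|exact: le..].
have [-> _] := dc_mulV ch (le 1 _ isT Vx).
have [-> _] := dc_mul1 ch (le 1 _ isT Vy).
by have [] := dc_mulV ch (le 1 _ isT Vy).
Qed.

Fixpoint Venv (n : nat) (s : seq H) : Prop :=
  if s is x :: s' then V n x /\ Venv n s' else True.

Lemma Venv_nth n s i : Venv n s -> V n (nth e s i).
Proof.
elim: s i => [|x s IH] [|i] /=; do ?[move=> _; exact: (dc_neu ch)]; case=> //.
by move=> _; exact: IH.
Qed.

Lemma Venv_le m n s : (m <= n)%N -> Venv n s -> Venv m s.
Proof. by move=> mn; elim: s => //= x s IH [/(dc_le mn) ? /IH]. Qed.

Variable s : seq H.

Fixpoint geval (t : gexp) : H :=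
  match t with
  | GOne => e
  | GVar i => nth e s i
  | GMul t1 t2 => tmul (geval t1) (geval t2)
  | GInv t1 => tinv (geval t1)
  end.

Definition leval (l : gletter) : H :=
  if l.1 then tinv (nth e s l.2) else nth e s l.2.

Definition weval (w : seq gletter) : H :=
  foldr (fun l y => tmul (leval l) y) e w.

Lemma leval_mem n l : Venv n.+1 s -> V n (leval l).
Proof.
move=> /Venv_nth sn; rewrite /leval; case: ifP => _.
  exact: (dc_invS ch).
exact: (dc_sub ch).
Qed.

Lemma weval_mem n w : Venv (n + size w).+1 s -> V n (weval w).
Proof.
elim: w n => [|l w IH] n /=; first by move=> _; exact: (dc_neu ch).
move=> sn; apply: (dc_mulS ch).
  by apply: leval_mem; apply: Venv_le sn; lia.
by apply: IH; apply: Venv_le sn; lia.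
Qed.

(** Cancelling reassociates two letters and the rest of the word, all needed at level 2; a letter
    may be an inverse, which costs a third level. *)
Lemma weval_gcons l w : Venv (size w + 3) s ->
  weval (gcons l w) = tmul (leval l) (weval w).
Proof.
case: w => [//|l' w] /= sn; case: ifP => // /andP[/eqP l2 l1].
have s3 : Venv 3 s by apply: Venv_le sn; exact: leq_addl.
have Vw : V 2 (weval w).
  by apply: weval_mem; apply: Venv_le sn; lia.
rewrite -(dc_mulA ch) //; [|exact: leval_mem..].
suff -> : tmul (leval l) (leval l') = e.
  by have [->] := dc_mul1 ch (dc_sub ch Vw).
rewrite /leval -l2.
have [xl xr] := dc_mulV ch (Venv_nth l.2 (Venv_le (isT : (1 <= 3)%N) s3)).
by case: l.1 l'.1 l1 => [] [].
Qed.

Lemma weval_gcat w1 w2 : Venv (size w1 + size w2 + 3) s ->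
  weval (gcat w1 w2) = tmul (weval w1) (weval w2).
Proof.
elim: w1 => [|l w1 IH] /= sn.
  have Vw : V 1 (weval w2).
    by apply: weval_mem; apply: Venv_le sn; lia.
  by have [->] := dc_mul1 ch Vw.
have sn' : Venv (size w1 + size w2 + 3) s by exact: Venv_le sn.
rewrite weval_gcons; last first.
  by apply: Venv_le sn'; rewrite leq_add2r size_gcat.
rewrite IH// (dc_mulA ch)//.
- by apply: leval_mem; apply: Venv_le sn'; exact: leq_addl.
- apply: weval_mem; apply: Venv_le sn'; lia.
- apply: weval_mem; apply: Venv_le sn'; lia.
Qed.

Lemma leval_inv l : Venv 4 s -> leval (~~ l.1, l.2) = tinv (leval l).
Proof.
move=> /Venv_nth s4; rewrite /leval /=; case: l.1 => //=.
by rewrite dc_invK.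
Qed.

(** The 6 comes from [dc_invM], which wants both factors at level 5, plus one level for letters that
    are inverses. *)
Lemma weval_ginv w : Venv (size w + 6) s -> weval (ginv w) = tinv (weval w).
Proof.
elim: w => [|l w IH] /= sn; first by rewrite dc_inv_neu.
have sn' : Venv (size w + 6) s by exact: Venv_le sn.
have s6 : Venv 6 s by apply: Venv_le sn; exact: leq_addl.
rewrite weval_gcat /=; last first.
  by apply: Venv_le sn; rewrite addn1 leq_add// ltnS size_ginv.
rewrite IH// leval_inv//; last exact: Venv_le s6.
have Vl : V 5 (leval l) by exact: leval_mem.
have Vw : V 5 (weval w).
  by apply: weval_mem; apply: Venv_le sn'; lia.
have [_ ->] := dc_mul1 ch (dc_le (isT : (1 <= 4)%N) (dc_invS ch Vl)).
by rewrite dc_invM.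
Qed.

Lemma geval_norm t : Venv (gsize t + 6) s -> geval t = weval (gnorm t).
Proof.
elim: t => [//|i|t1 IH1 t2 IH2|t IH] /= sn.
- rewrite /leval /=.
  by have [_ ->] := dc_mul1 ch (Venv_nth i (Venv_le (isT : (1 <= 7)%N) sn)).
- rewrite weval_gcat; last first.
    by apply: Venv_le sn; rewrite leq_add// leq_add// size_gnorm.
  rewrite IH1 ?IH2//; apply: Venv_le sn; rewrite leq_add2r.
  + exact: leq_addl.
  + exact: leq_addr.
- rewrite weval_ginv ?IH//; apply: Venv_le sn.
  by rewrite leq_add2r size_gnorm.
Qed.

Lemma local_identity t1 t2 : gnorm t1 = gnorm t2 ->
  Venv (maxn (gsize t1) (gsize t2) + 6) s -> geval t1 = geval t2.
Proof.
move=> t12 sn; rewrite !geval_norm ?t12//; apply: Venv_le sn; rewrite leq_add2r.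
  exact: leq_maxr.
exact: leq_maxl.
Qed.

End ChainGroup.

(** * The tangent operation *)

Ltac dc_leaf ch :=
  match goal with
  | h : ?V ?n ?x |- ?V ?m ?x =>
      first [ exact: (dc_le ch (isT : (m <= n)%N) h)
            | apply: (dc_le ch _ h); lia ]
  end.

Ltac dc_mem ch :=
  repeat first [exact: (dc_neu ch) | dc_leaf ch | apply: (dc_mulS ch)
    | apply: (dc_invS ch) | apply: (dc_beta ch)].

Ltac identity ch env t1 t2 :=
  apply: (local_identity ch (s := env) (t1 := t1) (t2 := t2) erefl);
  rewrite /=; repeat split; dc_mem ch.

Lemma tends_eq (R : realType) (Gam : Type) (G : dilData R Gam)
    (I : Type) (F : set_system I) (al : I -> Gam) (X Y : I -> G) (l : G) :
  Filter F -> (\forall i \near F, X i = Y i) ->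
  tends F al X l -> tends F al Y l.
Proof. by move=> FF XY Xl W /Xl; apply: filterS2 XY => i ->. Qed.

Section ChainSigma.
Variables (R : realType) (Gam : topologicalGroupType) (nu : Gam -> R).
Variables (H : dilData R Gam) (V : nat -> set H) (beta : H * H -> H).
Hypothesis ch : dil_chain nu V beta.
Local Notation e := (neu H).
Local Notation F0 := (nu0 nu).
Local Existing Instance nu0_filter.

Lemma bdilE x a u w : V 3 x -> V 3 u -> dil a (tmul (tinv x) u) = Some w ->
  V 1 w -> bdil x a u = Some (tmul x w).
Proof.
move=> Vx Vu aw Vw; rewrite /bdil (dc_inv ch); last by dc_mem ch.
rewrite /= (dc_mul ch); [|by dc_mem ch..].
by rewrite /= aw /= (dc_mul ch)//; dc_mem ch.
Qed.

Lemma dc_tmul_cvg I (F : set_system I) {FF : Filter F} (x y : I -> H) x0 y0 :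
  V 1 x0 -> V 1 y0 -> x @ F --> x0 -> y @ F --> y0 ->
  (fun i => tmul (x i) (y i)) @ F --> tmul x0 y0.
Proof.
move=> Ox Oy xx yy.
apply: (@cvg_comp _ _ _ (fun i => (x i, y i)) (fun p => tmul p.1 p.2)).
  exact: cvg_pair xx yy.
exact: (dc_mul_cont ch Ox Oy).
Qed.

Lemma dc_tinv_cvg I (F : set_system I) {FF : Filter F} (x : I -> H) x0 :
  V 1 x0 -> x @ F --> x0 -> (fun i => tinv (x i)) @ F --> tinv x0.
Proof.
by move=> Ox xx; apply: cvg_comp xx _; exact: (dc_inv_cont ch Ox).
Qed.

Lemma dc_tdil_cvg (x : Gam -> H) l : V 0 l -> x @ F0 --> l ->
  (fun a => tdil a (x a)) @ F0 --> e.
Proof.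
move=> Vl xl W /(dc_dil0 ch) aW; rewrite near_simpl.
have := xl _ (dc_near ch Vl); move: aW.
by apply: filterS2 => a aW /aW[].
Qed.

Lemma dc_tends_dil (x : Gam -> H) l : V 0 l -> x @ F0 --> l ->
  tends F0 id (fun a => tdil a (x a)) l.
Proof.
move=> Vl xl W lW; have V0 := dc_near ch (dc_neu ch 0).
have := xl _ lW; have := xl _ (dc_near ch Vl); have := dc_dil0 ch V0.
by apply: filterS3 => a aV /aV[ax _] /= Wx; exists (x a).
Qed.

Lemma dc_tends_cvg (X : Gam -> H) l : V 0 l -> tends F0 id X l -> X @ F0 --> e.
Proof.
move=> Vl Xl W eW; rewrite near_simpl.
have := Xl _ (dc_near ch Vl); have := dc_dil0 ch eW.
by apply: filterS2 => a /= aW [x /aW[-> Wx] [<-]].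
Qed.

(** Once [x] is cancelled, the quantity is [delta_a^-1 (delta_a U * delta_a t_a)], where [t_a] is
    [v] seen from the moving base point [p_a]. As [p_a] tends to [x], [t_a] tends to [U'], and
    [tends] absorbs the variation. *)
Lemma dc_Sigma x u v : V 12 x -> V 12 u -> V 12 v ->
  is_Sigma nu x u v (tmul x (beta (tmul (tinv x) u, tmul (tinv x) v))).
Proof.
move=> Vx Vu Vv.
set U := tmul (tinv x) u; set U' := tmul (tinv x) v.
have VU : V 10 U by dc_mem ch.
have VU' : V 10 U' by dc_mem ch.
pose A a := tdil a U.
pose p a := tmul x (A a); pose t a := tmul (tinv (p a)) v.
pose B a := tdil a (t a).
have Ac : A @ F0 --> e.
  by apply: dc_tdil_cvg (cvg_cst U); dc_mem ch.
have pc : p @ F0 --> x.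
  have [_ xe] := dc_mul1 ch (dc_le ch (isT : (1 <= 12)%N) Vx).
  rewrite -[X in _ --> X]xe; apply: dc_tmul_cvg Ac; try by dc_mem ch.
  exact: cvg_cst.
have tc : t @ F0 --> U'.
  apply: dc_tmul_cvg; try by dc_mem ch.
    by apply: dc_tinv_cvg pc; dc_mem ch.
  exact: cvg_cst.
have Bc : B @ F0 --> e by apply: dc_tdil_cvg tc; dc_mem ch.
have AB : tends F0 id (fun a => tmul (A a) (B a)) (beta (U, U')).
  apply: (dc_tendsM ch); try by dc_mem ch.
    by apply: dc_tends_dil (cvg_cst _); dc_mem ch.
  by apply: dc_tends_dil tc; dc_mem ch.
have Vb : V 9 (beta (U, U')) by dc_mem ch.
have ABb := dc_undil ch (dc_le ch (isT : (1 <= 9)%N) Vb) AB.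
have V12 := dc_near ch (dc_neu ch 12).
have V0 := dc_near ch (dc_neu ch 0).
rewrite /is_Sigma /plim => W bW.
have xc : (tmul x) @ beta (U, U') --> tmul x (beta (U, U')).
  apply: (dc_tmul_cvg (x := fun=> x) (y := id)); try by dc_mem ch.
    exact: cvg_cst.
have bV : nbhs (beta (U, U')) ((tmul x @^-1` W) `&` V 9).
  by apply: filterI; [exact: xc|exact: (dc_near ch)].
near=> a.
have VA : V 12 (A a) by near: a; exact: Ac.
have VB : V 12 (B a) by near: a; exact: Bc.
have Vp : V 12 (p a) by near: a; apply: pc; exact: (dc_near ch).
have Vt : V 10 (t a) by near: a; apply: tc; exact: (dc_near ch).
have dE y : V 0 y -> dil a y = Some (tdil a y).
  move=> Vy; suff : dil a y = Some (tdil a y) /\ V 0 (tdil a y) by case.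
  by move: y Vy; near: a; exact: (dc_dil0 ch).
have [y ay [Wy Vy]] : exists2 y,
    dil a^-1%g (tmul (A a) (B a)) = Some y & ((tmul x @^-1` W) `&` V 9) y.
  by near: a; exact: ABb.
have -> : bdil x a u = Some (p a).
  by apply: bdilE; try dc_mem ch; apply: dE; dc_mem ch.
rewrite /=.
have -> : bdil (p a) a v = Some (tmul (p a) (B a)).
  by apply: bdilE; try dc_mem ch; apply: dE; dc_mem ch.
rewrite /=; exists (tmul x y) => //; apply: bdilE; try by dc_mem ch.
rewrite -ay; congr dil.
identity ch [:: x; A a; B a]
  (GMul (GInv (GVar 0)) (GMul (GMul (GVar 0) (GVar 1)) (GVar 2)))
  (GMul (GVar 1) (GVar 2)).
Unshelve. all: by end_near. Qed.

End ChainSigma.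

(** * The double group *)

Section DoubleChain.
Variables (R : realType) (Gam : topologicalGroupType) (nu : Gam -> R).
Variables (G : dilData R Gam) (V : nat -> set G) (beta : G * G -> G).
Hypothesis ch : dil_chain nu V beta.
Local Notation F0 := (nu0 nu).
Local Existing Instance nu0_filter.
Hypothesis dc_tendsV : forall X l, V 1 l -> tends F0 id X l ->
  tends F0 id (fun a => tinv (X a)) (tinv l).
Local Notation e := (neu G).
Local Notation D := (double_group G).

(** The law of the double with each product replaced by [beta]; inversion is kept because, by H2, it
    is its own first-order part. *)
Definition double_beta (pq : D * D) : D :=
  (beta (pq.1.1, pq.2.1),
   beta (beta (beta (tinv pq.2.1, pq.1.2), pq.2.1), pq.2.2)).

(* One operation of the double has depth at most 4 in [G], and checking its
   group laws takes 20 more levels. *)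
Definition double_chain (n : nat) : set D :=
  [set p | V (n * 4 + 20) p.1 /\ V (n * 4 + 20) p.2].
Local Notation W := double_chain.

Lemma double_lmul (p q : D) : V 5 p.1 -> V 5 p.2 -> V 5 q.1 -> V 5 q.2 ->
  lmul p q = Some (tmul p.1 q.1,
    tmul (tmul (tmul (tinv q.1) p.2) q.1) q.2).
Proof.
move=> ? ? ? ?; rewrite /= (dc_mul ch) /=; [|dc_mem ch..].
rewrite (dc_inv ch) /=; last dc_mem ch.
do 3![rewrite (dc_mul ch) /=; [|dc_mem ch..]].
by [].
Qed.

Lemma double_tmul (p q : D) : V 5 p.1 -> V 5 p.2 -> V 5 q.1 -> V 5 q.2 ->
  tmul p q = (tmul p.1 q.1, tmul (tmul (tmul (tinv q.1) p.2) q.1) q.2).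
Proof. by move=> *; rewrite {1}/tmul double_lmul. Qed.

Lemma double_linv (p : D) : V 5 p.1 -> V 5 p.2 ->
  linv p = Some (tinv p.1, tmul (tmul p.1 (tinv p.2)) (tinv p.1)).
Proof.
move=> ? ?; rewrite /=.
do 2![rewrite (dc_inv ch) /=; [|dc_mem ch..]].
do 2![rewrite (dc_mul ch) /=; [|dc_mem ch..]].
by [].
Qed.

Lemma double_tinv (p : D) : V 5 p.1 -> V 5 p.2 ->
  tinv p = (tinv p.1, tmul (tmul p.1 (tinv p.2)) (tinv p.1)).
Proof. by move=> *; rewrite {1}/tinv double_linv. Qed.

Lemma double_dil a (p : D) x y : dil a p.1 = Some x -> dil a p.2 = Some y ->
  dil a p = Some (x, y).
Proof. by rewrite /= => -> ->. Qed.

Lemma double_dilP a (p q : D) : dil a p = Some q ->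
  dil a p.1 = Some q.1 /\ dil a p.2 = Some q.2.
Proof.
case: q => x' y' /=; case: (@dil R Gam G a p.1) => //= x.
by case: (@dil R Gam G a p.2) => //= y [-> ->].
Qed.

Lemma double_tends I (F : set_system I) (al : I -> Gam) (X : I -> D) (l : D) :
  Filter F -> tends F al X l <->
  tends F al (fun i => (X i).1) l.1 /\ tends F al (fun i => (X i).2) l.2.
Proof.
move=> FF; split=> [Xl|[X1 X2] A [[B1 B2] /= [B1l B2l] BA]].
  split=> A lA.
  - have lA' : nbhs l (A `*` setT).
      case: (l) lA => ? ? lA; exists (A, setT) => //.
      by split=> //; exact: filterT.
    apply: filterS (Xl _ lA') => i [p [/= Ap _] /double_dilP[ap _]].
    by exists p.1.
  - have lA' : nbhs l (setT `*` A).
      case: (l) lA => ? ? lA; exists (setT, A) => //.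
      by split=> //; exact: filterT.
    apply: filterS (Xl _ lA') => i [p [/= _ Ap] /double_dilP[_ ap]].
    by exists p.2.
apply: filterS2 (X1 _ B1l) (X2 _ B2l) => i [x Bx ax] [y By ay].
exists (x, y); first exact: BA.
apply: (etrans (double_dil (p := (x, y)) ax ay)).
by case: (X i).
Qed.

(** No norm on the double enters: topology and [tends] are componentwise, the group laws reduce to
    word identities in [G], and [double_beta] results from expanding the conjugation factor by
    factor. *)
Lemma double_dil_chain : dil_chain nu W double_beta.
Proof.
split.
- move=> n; rewrite (_ : W n =
    [set p | V (n * 4 + 20) p.1] `&` [set p | V (n * 4 + 20) p.2])//.
  apply: openI.
    apply: open_comp; last exact: (dc_open ch).
    by move=> p _; exact: cvg_fst.
  apply: open_comp; last exact: (dc_open ch).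
  by move=> p _; exact: cvg_snd.
- by move=> n; split; exact: (dc_neu ch).
- by move=> n p [p1 p2]; split; dc_mem ch.
- move=> p q [p1 p2] [q1 q2]; rewrite double_tmul ?double_lmul//; dc_mem ch.
- move=> n p q [p1 p2] [q1 q2]; rewrite double_tmul; try by dc_mem ch.
  by split=> /=; dc_mem ch.
- move=> p [p1 p2]; rewrite double_tinv ?double_linv//; dc_mem ch.
- move=> n p [p1 p2]; rewrite double_tinv; try by dc_mem ch.
  by split=> /=; dc_mem ch.
- move=> [p1 p2] [q1 q2] [r1 r2] [/= ? ?] [/= ? ?] [/= ? ?].
  rewrite (double_tmul (p := (p1, p2)) (q := (q1, q2))) /=; try by dc_mem ch.
  rewrite (double_tmul (p := (q1, q2)) (q := (r1, r2))) /=; try by dc_mem ch.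
  rewrite !double_tmul /=; try by dc_mem ch.
  congr pair; first by apply: (dc_mulA ch); dc_mem ch.
  identity ch [:: q1; p2; q2; r1; r2]
   (GMul (GMul (GMul (GInv (GVar 3)) (GMul (GMul (GMul (GInv (GVar 0)) (GVar 1))
     (GVar 0)) (GVar 2))) (GVar 3)) (GVar 4))
   (GMul (GMul (GMul (GInv (GMul (GVar 0) (GVar 3))) (GVar 1))
     (GMul (GVar 0) (GVar 3)))
     (GMul (GMul (GMul (GInv (GVar 3)) (GVar 2)) (GVar 3)) (GVar 4))).
- move=> [p1 p2] [/= ? ?]; rewrite !double_tmul /=; try by dc_mem ch.
  split; congr pair.
  + identity ch [:: p1] (GMul GOne (GVar 0)) (GVar 0).
  + identity ch [:: p1; p2]
      (GMul (GMul (GMul (GInv (GVar 0)) GOne) (GVar 0)) (GVar 1)) (GVar 1).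
  + identity ch [:: p1] (GMul (GVar 0) GOne) (GVar 0).
  + identity ch [:: p2]
      (GMul (GMul (GMul (GInv GOne) (GVar 0)) GOne) GOne) (GVar 0).
- move=> [p1 p2] [/= ? ?]; rewrite !double_tinv /=; try by dc_mem ch.
  rewrite !double_tmul /=; try by dc_mem ch.
  split; congr pair.
  + identity ch [:: p1] (GMul (GInv (GVar 0)) (GVar 0)) GOne.
  + identity ch [:: p1; p2] (GMul (GMul (GMul (GInv (GVar 0))
      (GMul (GMul (GVar 0) (GInv (GVar 1))) (GInv (GVar 0)))) (GVar 0))
      (GVar 1)) GOne.
  + identity ch [:: p1] (GMul (GVar 0) (GInv (GVar 0))) GOne.
  + identity ch [:: p1; p2]
      (GMul (GMul (GMul (GInv (GInv (GVar 0))) (GVar 1)) (GInv (GVar 0)))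
      (GMul (GMul (GVar 0) (GInv (GVar 1))) (GInv (GVar 0)))) GOne.
- move=> p q /[dup] Wp [p1 p2] /[dup] Wq [q1 q2].
  rewrite [tmul p q]double_tmul; try by dc_mem ch.
  have cp : (fun pq : D * D => pq.1) @ (p, q) --> p by exact: cvg_fst.
  have cq : (fun pq : D * D => pq.2) @ (p, q) --> q by exact: cvg_snd.
  have cp1 : (fun pq : D * D => pq.1.1) @ (p, q) --> p.1.
    by apply: cvg_comp cp _; exact: cvg_fst.
  have cp2 : (fun pq : D * D => pq.1.2) @ (p, q) --> p.2.
    by apply: cvg_comp cp _; exact: cvg_snd.
  have cq1 : (fun pq : D * D => pq.2.1) @ (p, q) --> q.1.
    by apply: cvg_comp cq _; exact: cvg_fst.
  have cq2 : (fun pq : D * D => pq.2.2) @ (p, q) --> q.2.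
    by apply: cvg_comp cq _; exact: cvg_snd.
  have c := dc_tmul_cvg ch; have c' := dc_tinv_cvg ch.
  apply: cvg_trans (cvg_pair (c _ _ _ _ _ _ _ _ _ cp1 cq1)
    (c _ _ _ _ _ _ _ _ _ (c _ _ _ _ _ _ _ _ _ (c _ _ _ _ _ _ _ _ _
       (c' _ _ _ _ _ _ cq1) cp2) cq1) cq2)); try by dc_mem ch.
  apply: near_eq_cvg; near=> pq; rewrite double_tmul//.
  + suff : V (1 * 4 + 20) pq.1.1 by move=> ?; dc_mem ch.
    by near: pq; apply: cp1; exact: (dc_near ch).
  + suff : V (1 * 4 + 20) pq.1.2 by move=> ?; dc_mem ch.
    by near: pq; apply: cp2; exact: (dc_near ch).
  + suff : V (1 * 4 + 20) pq.2.1 by move=> ?; dc_mem ch.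
    by near: pq; apply: cq1; exact: (dc_near ch).
  + suff : V (1 * 4 + 20) pq.2.2 by move=> ?; dc_mem ch.
    by near: pq; apply: cq2; exact: (dc_near ch).
- move=> p [p1 p2]; rewrite [tinv p]double_tinv; try by dc_mem ch.
  have cp1 : (fun p' : D => p'.1) @ p --> p.1.
    by case: (p) => ? ?; exact: cvg_fst.
  have cp2 : (fun p' : D => p'.2) @ p --> p.2.
    by case: (p) => ? ?; exact: cvg_snd.
  have c := dc_tmul_cvg ch; have c' := dc_tinv_cvg ch.
  apply: cvg_trans (cvg_pair (c' _ _ _ _ _ _ cp1) (c _ _ _ _ _ _ _ _ _
    (c _ _ _ _ _ _ _ _ _ cp1 (c' _ _ _ _ _ _ cp2)) (c' _ _ _ _ _ _ cp1)));
    try by dc_mem ch.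
  apply: near_eq_cvg; near=> p'; rewrite double_tinv//.
  + suff : V (1 * 4 + 20) p'.1 by move=> ?; dc_mem ch.
    by near: p'; apply: cp1; exact: (dc_near ch).
  + suff : V (1 * 4 + 20) p'.2 by move=> ?; dc_mem ch.
    by near: p'; apply: cp2; exact: (dc_near ch).
- by move=> n p q [p1 p2] [q1 q2]; split=> /=; dc_mem ch.
- move=> A [[B1 B2] /= [B1e B2e] BA].
  apply: filterS2 (dc_dil0 ch B1e) (dc_dil0 ch B2e) => a a1 a2 p [p1 p2].
  have [] := a1 p.1; first by dc_mem ch.
  have [] := a2 p.2; first by dc_mem ch.
  move=> d2 Bd2 d1 Bd1; have d := double_dil d1 d2.
  have -> : @tdil R Gam D a p = (tdil a p.1, tdil a p.2) by rewrite {1}/tdil d.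
  by split=> //; exact: BA.
- move=> X l [l1 l2] /double_tends[X1 X2] A [[B1 B2] /= [B1l B2l] BA].
  have l1' : V 1 l.1 by dc_mem ch.
  have l2' : V 1 l.2 by dc_mem ch.
  apply: filterS2 (dc_undil ch l1' X1 B1l) (dc_undil ch l2' X2 B2l) => a.
  move=> [x ax Bx] [y ay By]; exists (x, y); last exact: BA.
  exact: double_dil.
- move=> X Y l l' [l1 l2] [l1' l2'] /double_tends[X1 X2] /double_tends[Y1 Y2].
  have near_chain Z k n : V 0 k -> tends F0 id Z k ->
      \forall a \near F0, V n (Z a).
    move=> Vk Zk; apply: (dc_tends_cvg ch Vk Zk); apply: (dc_near ch).
    exact: (dc_neu ch).
  apply: (tends_eq (G := D) (X := fun a => (tmul (X a).1 (Y a).1,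
    tmul (tmul (tmul (tinv (Y a).1) (X a).2) (Y a).1) (Y a).2) : D)).
    near=> a; rewrite double_tmul//.
    - by near: a; apply: (near_chain _ l.1) X1; dc_mem ch.
    - by near: a; apply: (near_chain _ l.2) X2; dc_mem ch.
    - by near: a; apply: (near_chain _ l'.1) Y1; dc_mem ch.
    - by near: a; apply: (near_chain _ l'.2) Y2; dc_mem ch.
  apply/double_tends; split=> /=.
    by apply: (dc_tendsM ch) => //; dc_mem ch.
  apply: (dc_tendsM ch) => //; try by dc_mem ch.
  apply: (dc_tendsM ch) => //; try by dc_mem ch.
  apply: (dc_tendsM ch) => //; try by dc_mem ch.
  by apply: dc_tendsV => //; dc_mem ch.
Unshelve. all: by end_near. Qed.

End DoubleChain.

(** * A chain of neighbourhoods in [G]; dilatations as local morphisms of [beta] *)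

Section GroupChain.
Variables (R : realType) (Gam : topologicalGroupType) (nu : Gam -> R).
Hypothesis hnu : dilatation_parameter nu.
Variable G : dilData R Gam.
Local Notation e := (neu G).
Variables (O : set G) (beta : G * G -> G) (N : G -> R).
Hypothesis rO : regular_nbhd nu O beta N.
Local Notation F0 := (nu0 nu).
Local Existing Instance nu0_filter.

Let F0_proper : ProperFilter F0 := nu0_proper hnu.
Local Existing Instance F0_proper.

(** Multiplication, inversion and [beta] are continuous at the neutral element and preserve it. *)
Lemma chain_step (A : set G) : open A -> A e -> exists B : set G,
  [/\ open B, B e, B `<=` A &
    forall x y, B x -> B y -> [/\ A (tmul x y), A (tinv x) & A (beta (x, y))]].
Proof.
move=> oA Ae; have nA : nbhs e A by exact: open_nbhs_nbhs.
have Oe := rn_neu rO.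
have [M [nM MA]] := nbhs_mul11 rO nA.
have iA := rn_inv_cont rO Oe; rewrite (rn_inv_neu rO) in iA.
have bA := beta_cont hnu rO Oe Oe; rewrite (beta_neu hnu rO) in bA.
have [[B1 B2] /= [nB1 nB2] B12] := bA _ nA.
pose B := (A `&` M `&` (tinv (G := G) @^-1` A) `&` B1 `&` B2).
have nB : nbhs e B by do ![apply: filterI => //]; exact: iA.
exists B°; split;
  [exact: open_interior|exact: nbhs_singleton (nbhs_interior nB)| |].
  by move=> x /interior_subset[[[[]]]].
move=> x y /interior_subset[[[[_ Mx] ?] B1x] _].
move=> /interior_subset[[[[_ My] _] _] B2y].
by split; [exact: MA| |exact: (B12 (x, y))].
Qed.

Lemma exists_dil_chain : exists V : nat -> set G,
  dil_chain nu V beta /\ forall n, V n `<=` O.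
Proof.
(* [choice] wants a successor for every set, hence a relation that is vacuous off the open sets
   containing [e]. *)
have [f fP] := @choice (set G) (set G)
  (fun A B => open A -> A e -> [/\ open B, B e, B `<=` A &
    forall x y, B x -> B y -> [/\ A (tmul x y), A (tinv x) & A (beta (x, y))]])
  (fun A => match pselect (open A /\ A e) with
    | left h => let: ex_intro B hB := chain_step h.1 h.2 in
      ex_intro _ B (fun _ _ => hB)
    | right h => ex_intro _ A (fun h1 h2 => False_ind _ (h (conj h1 h2))) end).
pose V n := iter n f O.
have VP n : open (V n) /\ V n e.
  elim: n => [|n [oV Ve]]; first by split; [exact: rn_open rO|exact: rn_neu rO].
  by have [] := fP _ oV Ve.
have VS n := fP (V n) (VP n).1 (VP n).2.
have VO n : V n `<=` O.
  elim: n => [//|n IH]; apply: subset_trans IH; by have [] := VS n.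
have idF : id @ F0 --> F0 by [].
exists V; split => //; split.
- by move=> n; have [] := VP n.
- by move=> n; have [] := VP n.
- by move=> n; have [_ _] := VS n.
- by move=> x y /VO Ox /VO; exact: (rn_mul rO).
- by move=> n x y Vx Vy; have [_ _ _ /(_ _ _ Vx Vy)[]] := VS n.
- by move=> x /VO; exact: (rn_inv rO).
- by move=> n x Vx; have [_ _ _ /(_ _ _ Vx Vx)[]] := VS n.
- by move=> x y z /VO Ox /VO Oy /VO; exact: (rn_mulA rO).
- by move=> x /VO; exact: (rn_mul1 rO).
- by move=> x /VO; exact: (rn_mulV rO).
- by move=> x y /VO Ox /VO; exact: (rn_mul_cont rO).
- by move=> x /VO; exact: (rn_inv_cont rO).
- by move=> n x y Vx Vy; have [_ _ _ /(_ _ _ Vx Vy)[]] := VS n.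
- exact: (dil_near0 rO).
- by move=> X l /VO; exact: (tends_undil hnu rO idF).
- move=> X Y l l' Vl Vl'; have [_ _ _ /(_ _ _ Vl Vl')[_ _ Ob]] := VS 0%N.
  exact: (tendsM hnu rO idF (VO _ _ Vl) (VO _ _ Vl') Ob).
Qed.

(** The product [delta_b x' * delta_b y'] has first-order part [beta (x', y')] at scale [b], and
    [beta (x, y)] at scale [b * a] because [delta_b x' = delta_(b a) x]. Applying [delta_a] to the
    latter brings it to scale [b], where first-order parts are unique. *)
Lemma dil_beta a x y x' y' r : O x -> O y -> O x' -> O y' -> O r ->
  O (beta (x, y)) -> O (beta (x', y')) ->
  O (tinv r) -> O (tmul (tinv r) (beta (x', y'))) ->
  dil a x = Some x' -> dil a y = Some y' ->
  (\forall z \near beta (x, y), exists w, dil a z = Some w) ->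
  dil a (beta (x, y)) = Some r -> r = beta (x', y').
Proof.
move=> Ox Oy Ox' Oy' Or Ob Ob' Or' Orb ax ay adef ar.
have idF : id @ F0 --> F0 by [].
have alF : (fun b => b * a)%g @ F0 --> F0 by move=> P; exact: nu0_mulr.
pose X b := tdil b x'; pose Y b := tdil b y'.
have XYb' : tends F0 id (fun b => tmul (X b) (Y b)) (beta (x', y')).
  apply: (tendsM hnu rO idF) => //; apply: (tends_dil rO idF) => //;
    exact: cvg_cst.
have shift z z' : O z -> O z' -> dil a z = Some z' ->
    tends F0 (fun b => b * a)%g (fun b => tdil b z') z.
  move=> Oz Oz' az.
  apply: (tends_eq (X := fun b => tdil (b * a)%g z)); last first.
    by apply: (tends_dil rO alF) => //; exact: cvg_cst.
  have := alF _ (dil_defined0 rO); have := dil_defined0 rO.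
  apply: filterS2 => b bO baO.
  by apply/esym/(dil_comp rO Oz Oz' az); [exact: baO|exact: bO].
have XYb : tends F0 (fun b => b * a)%g (fun b => tmul (X b) (Y b))
    (beta (x, y)).
  by apply: (tendsM hnu rO alF) => //; exact: shift.
apply: (tends_unique hnu rO idF Or Ob' Or' Orb _ XYb') => W rW.
have rWO : nbhs r (W `&` O) by apply: filterI => //; exact: (rn_nbhs rO).
have ac := tdil_cvg rO Ob adef; rewrite /tdil ar /= -/(tdil _) in ac.
have nb : nbhs (beta (x, y)) ((tdil a @^-1` (W `&` O)) `&` O `&`
    [set z | exists w, dil a z = Some w]).
  by apply: filterI => //; apply: filterI (rn_nbhs rO Ob); exact: ac.
apply: filterS2 (dil_defined0 rO) (XYb _ nb) => b bO.
move=> [z [[[/= Wz Oaz] Oz] [w azw]] baz]; exists (tdil a z) => //.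
have az : dil a z = Some (tdil a z) by rewrite /tdil azw.
by rewrite /= bO//; congr Some; exact: (dil_comp rO Oz Oaz az baz (bO _ Oaz)).
Qed.

End GroupChain.

(** * Differentiability of the operation *)

Section OperationDifferentiable.
Variables (R : realType) (Gam : topologicalGroupType) (nu : Gam -> R).
Hypothesis hnu : dilatation_parameter nu.
Variable G : dilData R Gam.
Local Notation e := (neu G).
Local Notation D := (double_group G).
Variables (O : set G) (beta : G * G -> G) (N : G -> R).
Hypothesis rO : regular_nbhd nu O beta N.
Variable V : nat -> set G.
Hypothesis ch : dil_chain nu V beta.
Hypothesis VO : forall n, V n `<=` O.
Local Notation F0 := (nu0 nu).
Local Existing Instance nu0_filter.

Let F0_proper : ProperFilter F0 := nu0_proper hnu.
Local Existing Instance F0_proper.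
Let idF : id @ F0 --> F0. Proof. by []. Qed.

Let dc_tendsV X l : V 1 l -> tends F0 id X l ->
  tends F0 id (fun a => tinv (X a)) (tinv l).
Proof.
move=> Vl; apply: (tends_inv rO idF); first exact: VO Vl.
exact: VO (dc_invS ch Vl).
Qed.

Let chD := double_dil_chain ch dc_tendsV.

Lemma dc_tends_unique X l l' : V 3 l -> V 3 l' ->
  tends F0 id X l -> tends F0 id X l' -> l = l'.
Proof.
by move=> Vl Vl'; apply: (tends_unique hnu rO idF); apply: (VO (n := 0));
  dc_mem ch.
Qed.

Lemma tends_near_chain X l n : V 0 l -> tends F0 id X l ->
  \forall a \near F0, V n (X a).
Proof.
move=> Vl Xl; apply: (dc_tends_cvg ch Vl Xl); apply: (dc_near ch).
exact: (dc_neu ch).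
Qed.

(** The product [(delta_a b)^-1 * delta_a b] is [e], which is [delta_a e] and so has first-order
    part [e]. *)
Lemma beta_inv b : V 5 b -> beta (tinv b, b) = e.
Proof.
move=> Vb.
have tb : tends F0 id (fun a => tdil a b) b.
  by apply: (dc_tends_dil ch) (cvg_cst b); dc_mem ch.
apply: (dc_tends_unique (X := fun=> e)); try by dc_mem ch.
  apply: (tends_eq (X := fun a => tmul (tinv (tdil a b)) (tdil a b)));
    last first.
    apply: (dc_tendsM ch) => //; try by dc_mem ch.
    by apply: dc_tendsV => //; dc_mem ch.
  have V0b : V 0 b by dc_mem ch.
  apply: filterS (tends_near_chain 1 V0b tb) => a Va.
  by have [] := dc_mulV ch Va.
move=> W /nbhs_singleton We; apply: nearW => a; exists e => //.
exact: (dil_neu hnu rO).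
Qed.

(** One product of four dilated points is expanded along two expressions of it; uniqueness of the
    first-order part identifies the results. *)
Lemma double_beta_morph p q : V 10 p.1 -> V 10 p.2 -> V 10 q.1 -> V 10 q.2 ->
  beta (double_beta beta (p, q)) = beta (beta p, beta q).
Proof.
move: p q => [p1 p2] [q1 q2] /= Vp1 Vp2 Vq1 Vq2; rewrite /double_beta /=.
have tb b : V 10 b -> tends F0 id (fun a => tdil a b) b.
  by move=> Vb; apply: (dc_tends_dil ch) (cvg_cst b); dc_mem ch.
have tn b : V 10 b -> \forall a \near F0, V 20 (tdil a b).
  move=> Vb; have V0b : V 0 b by dc_mem ch.
  exact: tends_near_chain 20 V0b (tb _ Vb).
pose A b a := tdil a b : G.
apply: (dc_tends_unique (X := fun a =>
    tmul (tmul (A p1 a) (A p2 a)) (tmul (A q1 a) (A q2 a)))).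
- dc_mem ch.
- dc_mem ch.
- apply: (tends_eq (X := fun a => tmul (tmul (A p1 a) (A q1 a))
    (tmul (tmul (tmul (tinv (A q1 a)) (A p2 a)) (A q1 a)) (A q2 a)))).
    near=> a.
    have V1 : V 20 (A p1 a) by near: a; exact: tn.
    have V2 : V 20 (A p2 a) by near: a; exact: tn.
    have V3 : V 20 (A q1 a) by near: a; exact: tn.
    have V4 : V 20 (A q2 a) by near: a; exact: tn.
    identity ch [:: A p1 a; A p2 a; A q1 a; A q2 a]
      (GMul (GMul (GVar 0) (GVar 2))
        (GMul (GMul (GMul (GInv (GVar 2)) (GVar 1)) (GVar 2)) (GVar 3)))
      (GMul (GMul (GVar 0) (GVar 1)) (GMul (GVar 2) (GVar 3))).
  do 4?[apply: (dc_tendsM ch); [by dc_mem ch|by dc_mem ch| |]];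
    try exact: tb.
  by apply: dc_tendsV; [by dc_mem ch|exact: tb].
- by do 2?[apply: (dc_tendsM ch); [by dc_mem ch|by dc_mem ch| |]]; exact: tb.
Unshelve. all: by end_near. Qed.

Local Notation W := (double_chain V).

Definition op_diff (X u : D) : G :=
  tmul (tmul X.1 X.2) (beta (tmul (tinv X) u)).

(** [F] stays abstract so that one proof serves both commutation clauses of a conical morphism: a
    single coefficient, and all coefficients close to 0. *)
Lemma op_diff_dil (F : set_system Gam) {FF : Filter F} (X : D) :
  (forall A, nbhs e A -> exists2 U, nbhs e U &
    \forall a \near F, forall u, U u -> exists2 y, dil a u = Some y & A y) ->
  W 30 X -> exists2 U, nbhs X U & \forall a \near F, forall u, U u ->
    exists2 u', bdil X a u = Some u' &
      bdil (tmul X.1 X.2) a (op_diff X u) = Some (op_diff X u').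
Proof.
move=> Fsmall WX; have [VX1 VX2] := WX.
have [U nU FU] := Fsmall _ (dc_near ch (dc_neu ch 100)).
(* [dil_beta] requires [dil a] to be defined on a whole neighbourhood of [beta P], hence the
   interior. *)
have nUo : nbhs e U° by exact: nbhs_interior.
have betaU : beta @ (e, e) --> e.
  by rewrite -[X in _ --> X](beta_neu hnu rO);
    exact: (beta_cont hnu rO (rn_neu rO) (rn_neu rO)).
pose S : set D := W 10 `&` (U° `*` U°) `&` beta @^-1` U°.
have nS : nbhs (neu D) S.
  apply: filterI; last exact: betaU.
  by apply: filterI; [exact: (dc_near chD (dc_neu chD 10))|exists (U°, U°)].
have cX : (fun u => tmul (tinv X) u) @ X --> neu D.
  have [<- _] := dc_mulV chD (dc_le chD (isT : (1 <= 30)%N) WX).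
  by apply: (dc_tmul_cvg chD (x := fun=> tinv X) (y := id));
    [dc_mem chD|dc_mem chD|exact: cvg_cst|].
exists (W 30 `&` (fun u => tmul (tinv X) u) @^-1` S).
  by apply: filterI; [exact: (dc_near chD)|exact: cX].
apply: filterS FU => a FU u [Wu /= [[WP [UP1 UP2]] UbP]].
rewrite /op_diff; set P : D := tmul (tinv X) u in WP UP1 UP2 UbP *.
have [VP1 VP2] := WP.
have [p1 ap1 Vp1] := FU _ (interior_subset UP1).
have [p2 ap2 Vp2] := FU _ (interior_subset UP2).
have [r ar Vr] := FU _ (interior_subset UbP).
have aP := double_dil ap1 ap2.
have rE : r = beta (p1, p2).
  have bP : beta P = beta (P.1, P.2) by rewrite -surjective_pairing.
  have nUb : nbhs (beta P) U by exact: UbP.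
  rewrite bP in ar nUb; apply: (dil_beta hnu rO _ _ _ _ _ _ _ _ _ ap1 ap2 _ ar);
    try by [apply: (VO (n := 0)); dc_mem ch].
  by apply: filterS nUb => z /FU[y]; exists y.
have WQ : W 1 (p1, p2) by split=> /=; dc_mem ch.
exists (tmul X (p1, p2)).
  by apply: (bdilE chD) => //; dc_mem chD.
have -> : tmul (tinv X) (tmul X (p1, p2)) = (p1, p2).
  identity chD [:: X; (p1, p2) : D]
    (GMul (GInv (GVar 0)) (GMul (GVar 0) (GVar 1))) (GVar 1); dc_mem ch.
have VbP : V 50 (beta P) by rewrite [P]surjective_pairing; dc_mem ch.
rewrite -rE; apply: (bdilE ch); try by dc_mem ch.
rewrite -ar; congr dil.
identity ch [:: X.1; X.2; beta P]
  (GMul (GInv (GMul (GVar 0) (GVar 1)))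
    (GMul (GMul (GVar 0) (GVar 1)) (GVar 2)))
  (GVar 2).
Qed.

Lemma dil_small_at a A : nbhs e A -> exists2 U, nbhs e U &
  forall u, U u -> exists2 y, dil a u = Some y & A y.
Proof.
move=> nA; have Oe := rn_neu rO; have def := rn_dil_near rO a.
have := tdil_cvg rO Oe def; rewrite /tdil (dil_neu hnu rO) /= => ac.
exists ([set u | exists y, dil a u = Some y] `&` @tdil R Gam G a @^-1` A).
  by apply: filterI => //; exact: ac.
by move=> u [[y ay] Ay]; exists y => //; move: Ay; rewrite /= /tdil ay.
Qed.

Lemma dil_small0 A : nbhs e A -> exists2 U, nbhs e U &
  \forall a \near F0, forall u, U u -> exists2 y, dil a u = Some y & A y.
Proof.
move=> nA; exists O; first exact: (rn_nbhs rO (rn_neu rO)).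
by apply: filterS (dil_near0 rO nA) => a aA u /aA[]; exists (tdil a u).
Qed.

Lemma op_diff_conical X : W 30 X ->
  conical_morphism_near nu (op_diff X) X (tmul X.1 X.2).
Proof.
move=> WX; have [VX1 VX2] := WX; split.
- exists (W 30); first exact: (dc_near chD).
  move=> u v Wu Wv; exists (tmul X (double_beta beta
    (tmul (tinv X) u, tmul (tinv X) v))).
    by apply: (dc_Sigma chD); dc_mem chD.
  set P : D := tmul (tinv X) u; set Q : D := tmul (tinv X) v.
  have WP : W 28 P by rewrite /P; dc_mem chD.
  have WQ : W 28 Q by rewrite /Q; dc_mem chD.
  have WPQ : W 27 (double_beta beta (P, Q)) by dc_mem chD.
  have [VP1 VP2] := WP; have [VQ1 VQ2] := WQ.
  have VbP : V 60 (beta P) by rewrite [P]surjective_pairing; dc_mem ch.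
  have VbQ : V 60 (beta Q) by rewrite [Q]surjective_pairing; dc_mem ch.
  rewrite /op_diff -/P -/Q.
  have -> : tmul (tinv X) (tmul X (double_beta beta (P, Q))) =
      double_beta beta (P, Q).
    identity chD [:: X; double_beta beta (P, Q)]
      (GMul (GInv (GVar 0)) (GMul (GVar 0) (GVar 1))) (GVar 1); dc_mem ch.
  (* Rewriting [beta P] as [(op X)^-1 * (op X * beta P)] gives the expected value the shape produced
     by [dc_Sigma] at the base point [op X]. *)
  have cancel b : V 60 b ->
      tmul (tinv (tmul X.1 X.2)) (tmul (tmul X.1 X.2) b) = b.
    move=> Vb; identity ch [:: X.1; X.2; b]
      (GMul (GInv (GMul (GVar 0) (GVar 1)))
        (GMul (GMul (GVar 0) (GVar 1)) (GVar 2))) (GVar 2).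
  rewrite double_beta_morph; try by dc_mem ch.
  rewrite -[X in is_Sigma _ _ _ _ (tmul _ (beta (X, _)))](cancel (beta P))//.
  rewrite -[X in is_Sigma _ _ _ _ (tmul _ (beta (_, X)))](cancel (beta Q))//.
  by apply: (dc_Sigma ch); dc_mem ch.
- move=> a; have [|U nU UX] := op_diff_dil (F := globally [set a]) _ WX.
    move=> A /(dil_small_at a)[U nU UA].
    by exists U => // _ ->.
  by apply: filterS nU => u; exact: UX.
- exact: op_diff_dil dil_small0 WX.
Qed.

(** The limit is joint in [u] and [a]: this is what compactness upgrades to uniformity on [K], which
    a limit at each fixed [u] would not give. *)
Lemma op_diff_lim X u0 (E : set (R * R)) : W 30 X -> W 30 u0 -> entourage E ->
  \forall u \near u0 & a \near F0, exists2 r : R,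
    (olet p := bdil X a u in olet fp := op p in
     olet q := bdil (tmul X.1 X.2) a (op_diff X u) in
     omap (fun r : R => r / nu a) (ldist fp q)) = Some r & E (0, r).
Proof.
move=> WX Wu0 entE; have [VX1 VX2] := WX.
pose F := filter_prod (nbhs u0) F0.
have FF : Filter F by exact: filter_prod_filter.
have fF : @fst D Gam @ F --> u0 by exact: cvg_fst.
have alF : @snd D Gam @ F --> F0 by exact: cvg_snd.
pose P (i : D * Gam) : D := tmul (tinv X) i.1.
pose P0 : D := tmul (tinv X) u0.
have Pc : P @ F --> P0.
  by apply: (dc_tmul_cvg chD (x := fun=> tinv X) (y := fst));
    [dc_mem chD|dc_mem chD|exact: cvg_cst|exact: cvg_fst].
have WP0 : W 28 P0 by rewrite /P0; dc_mem chD.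
have [VP1 VP2] := WP0.
have V1 : V 60 P0.1 by dc_mem ch.
have V2 : V 60 P0.2 by dc_mem ch.
have VO' n x : V n x -> O x by exact: VO.
have Vb : V 59 (beta P0) by rewrite [P0]surjective_pairing; dc_mem ch.
have fst_c (p : D) : fst @ p --> p.1 by case: p => ? ?; exact: cvg_fst.
have snd_c (p : D) : snd @ p --> p.2 by case: p => ? ?; exact: cvg_snd.
pose A i := tdil i.2 (P i).1; pose B i := tdil i.2 (P i).2.
pose C i := tdil i.2 (beta (P i)).
have bc : beta @ P0 --> beta P0.
  rewrite [P0]surjective_pairing.
  exact: (beta_cont hnu rO (VO' _ _ V1) (VO' _ _ V2)).
have tA : tends F snd A P0.1.
  apply: (tends_dil rO alF (VO' _ _ V1)); exact: (cvg_comp P fst) Pc (fst_c _).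
have tB : tends F snd B P0.2.
  apply: (tends_dil rO alF (VO' _ _ V2)); exact: (cvg_comp P snd) Pc (snd_c _).
have tC : tends F snd C (beta P0).
  apply: (tends_dil rO alF (VO' _ _ Vb)); exact: (cvg_comp P beta) Pc bc.
have tAB : tends F snd (fun i => tmul (A i) (B i)) (beta P0).
  rewrite [P0]surjective_pairing; apply: (tendsM hnu rO alF) => //;
    by [exact: VO' V1|exact: VO' V2|rewrite -surjective_pairing; exact: VO' Vb].
have tZ : tends F snd (fun i => tmul (tinv (tmul (A i) (B i))) (C i)) e.
  have Vb' := dc_invS ch Vb.
  rewrite -(beta_inv (dc_le ch (isT : (5 <= 59)%N) Vb)).
  apply: (tendsM hnu rO alF) => //;
    [exact: VO' Vb'|exact: VO' Vb| |].
    rewrite (beta_inv (dc_le ch (isT : (5 <= 59)%N) Vb)); exact: (rn_neu rO).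
  by apply: (tends_inv rO alF) => //; [exact: VO' Vb|exact: VO' Vb'].
have Z0 : (fun i => nrm (tmul (tinv (tmul (A i) (B i))) (C i)) / nu i.2) @ F
    --> (0 : R).
  by rewrite -(N_neu hnu rO); exact: (tends_nrm hnu rO alF (rn_neu rO) tZ).
have nZ : \forall i \near F,
    E (0, nrm (tmul (tinv (tmul (A i) (B i))) (C i)) / nu i.2).
  exact: (iffLR (cvg_app_entourageP _ _ _) Z0 E entE).
have Ve n : nbhs e (V n) := dc_near ch (dc_neu ch n).
suff : \forall i \near F, exists2 r : R,
    (olet p := bdil X i.2 i.1 in olet fp := op p in
     olet q := bdil (tmul X.1 X.2) i.2 (op_diff X i.1) in
     omap (fun r : R => r / nu i.2) (ldist fp q)) = Some r & E (0, r).
  by [].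
near=> i.
have Wi : W 30 i.1.
  by near: i; exact: (fF _ (dc_near chD Wu0)).
have VA : V 60 (A i) by near: i; exact: (tends_cvg rO alF (VO' _ _ V1) tA).
have VB : V 60 (B i) by near: i; exact: (tends_cvg rO alF (VO' _ _ V2) tB).
have VC : V 60 (C i) by near: i; exact: (tends_cvg rO alF (VO' _ _ Vb) tC).
have WPi : W 28 (P i) by rewrite /P; dc_mem chD.
have [VP1' VP2'] := WPi.
have Vbi : V 60 (beta (P i)) by rewrite [P i]surjective_pairing; dc_mem ch.
have di x : O x -> dil i.2 x = Some (tdil i.2 x).
  by move: x; near: i; exact: (alF _ (dil_defined0 rO)).
have dPi := double_dil (di _ (VO' _ _ VP1')) (di _ (VO' _ _ VP2')).
exists (nrm (tmul (tinv (tmul (A i) (B i))) (C i)) / nu i.2); last first.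
  by near: i; exact: nZ.
rewrite (bdilE chD _ _ dPi); try by dc_mem chD.
  rewrite /= (double_tmul ch) /=; try by dc_mem ch.
  rewrite /op /= (dc_mul ch); try by dc_mem ch.
  rewrite -/(A i) -/(B i); have -> : bdil (tmul X.1 X.2) i.2 (op_diff X i.1) =
      Some (tmul (tmul X.1 X.2) (C i)).
    rewrite /op_diff -/(P i); apply: (bdilE ch); try by dc_mem ch.
    rewrite -(di _ (VO' _ _ Vbi)); congr dil.
    identity ch [:: X.1; X.2; beta (P i)]
      (GMul (GInv (GMul (GVar 0) (GVar 1)))
        (GMul (GMul (GVar 0) (GVar 1)) (GVar 2))) (GVar 2).
  rewrite /= /ldist (dc_inv ch); last by dc_mem ch.
  rewrite /= (dc_mul ch); try by dc_mem ch.
  (* The distance is left invariant, so the factor [X.1 * X.2] cancels inside the norm. *)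
  rewrite /=; congr (Some (nrm _ / _)).
  identity ch [:: X.1; X.2; A i; B i; C i]
    (GMul (GInv (GMul (GMul (GVar 0) (GVar 2))
        (GMul (GMul (GMul (GInv (GVar 2)) (GVar 1)) (GVar 2)) (GVar 3))))
      (GMul (GMul (GVar 0) (GVar 1)) (GVar 4)))
    (GMul (GInv (GMul (GVar 2) (GVar 3))) (GVar 4)).
by split=> /=; dc_mem ch.
Unshelve. all: by end_near. Qed.

End OperationDifferentiable.

Theorem theorem16 (R : realType) (Gam : topologicalGroupType) (nu : Gam -> R)
    (hnu : dilatation_parameter nu) (G : dilData R Gam)
    (hlc : locally_compact [set: G])
    (hG : normed_group_with_dilatations nu G) :
  dil_differentiable nu (@op R Gam G).
Proof.
have [O [beta [N rO]]] := exists_regular_nbhd hG.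
have [V [ch VO]] := exists_dil_chain hnu rO.
have Ve := dc_near ch (dc_neu ch (30 * 4 + 20)).
have nW : nbhs (neu (double_group G)) (double_chain V 30).
  by exists (V (30 * 4 + 20)%N, V (30 * 4 + 20)%N).
apply: filterS nW => X WX; have [VX1 VX2] := WX.
have XW : nbhs X (double_chain V 30).
  case: X WX VX1 VX2 => x y _ /= Vx Vy.
  exists (V (30 * 4 + 20)%N, V (30 * 4 + 20)%N) => //.
  by split; exact: (dc_near ch).
have opE : op X = Some (tmul X.1 X.2) by rewrite /op (dc_mul ch); dc_mem ch.
split; exists (tmul X.1 X.2) => //.
  move=> A XA.
  have c : (fun p : double_group G => tmul p.1 p.2) @ X --> tmul X.1 X.2.
    case: X WX VX1 VX2 {XW opE XA} => x y _ /= Vx Vy.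
    by apply: (dc_mul_cont ch); dc_mem ch.
  apply: filterS2 XW (c _ XA) => p [p1 p2] Ap; exists (tmul p.1 p.2) => //.
  by rewrite /op (dc_mul ch); dc_mem ch.
exists (op_diff beta X); first exact: (op_diff_conical hnu rO ch VO).
exists (double_chain V 30) => // K KW /compact_near_coveringP cK E entE.
apply: (cK _ _ _ (nu0_filter nu)) => u /KW Wu.
exact: (op_diff_lim hnu rO ch VO).
Qed.
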